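(* Let $\Gamma_n=\{\gamma^1_n,\gamma^2_n,\gamma^3_n\}$ be a sequence of $3$--networks of class $H^2$, each having one of its triple junctions at the origin, such that $$\limsup_{n}\overline{F}(\Gamma_n)<+\infty .$$ Then $\Gamma_n$ converges, up to a subsequence, weakly in $H^2$ and strongly in $C^{1,\alpha}$ with $\alpha\in(0,\frac12)$ to a network $\Gamma$. The network $\Gamma$ is either a Theta--network or a ''degenerate'' Theta--network.
   Context: Curves are parametrized on $[0,1]$ with constant speed equal to their length $L(\gamma)$; a curve of length zero is constant. A curve is regular if $|\partial_x\gamma|\ne0$ on $[0,1]$; then $\tau=\partial_x\gamma/|\partial_x\gamma|$ is its unit tangent. A $3$--network of class $H^2$ is a union of three curves $\gamma^1,\gamma^2,\gamma^3:[0,1]\to\mathbb{R}^2$ of class $H^2$ meeting at two triple junctions: $\gamma^1(0)=\gamma^2(0)=\gamma^3(0)$ and $\gamma^1(1)=\gamma^2(1)=\gamma^3(1)$. Lengths are allowed to be zero (no regularity is required). Convergence of networks (weak in $H^2$, strong in $C^{1,\alpha}$) means convergence of $\gamma^i_n$ to $\gamma^i$ on $[0,1]$ in the corresponding sense for $i=1,2,3$. A Theta--network is a $3$--network of class $H^2$ whose three curves are regular and form angles of $120$ degrees at both junctions: $\sum_{i=1}^3\tau^i(0)=0$ and $\sum_{i=1}^3\tau^i(1)=0$. The curves may intersect and self-intersect. A ''degenerate'' Theta--network is a $3$--network consisting of two regular curves $\gamma^1,\gamma^2$ of class $H^2$, forming angles in pairs of $120$ and $60$ degrees, and of a curve $\gamma^3$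 of length zero. Explicitly (up to relabeling the curves): $\gamma^3$ is constant equal to $P$, $\gamma^1(0)=\gamma^1(1)=\gamma^2(0)=\gamma^2(1)=P$, and, with the orientations inherited from the network, the vectors $\tau^1(0),\tau^2(0)$ form an angle of $120$ degrees and $\{\tau^1(0),\tau^2(0)\}=\{\tau^1(1),\tau^2(1)\}$. The functional $\overline{F}$ on $3$--networks of class $H^2$ is: $\overline{F}(\Gamma)=\sum_{i=1}^3\Big(\frac{1}{L^3(\gamma^i)}\int_0^1|\gamma^i_{xx}|^2\,\mathrm{d}x+L(\gamma^i)\Big)$ if $\Gamma$ is a Theta--network; $\overline{F}(\Gamma)=\sum_{i=1}^2\Big(\frac{1}{L^3(\gamma^i)}\int_0^1|\gamma^i_{xx}|^2\,\mathrm{d}x+L(\gamma^i)\Big)$ (sum over the two curves of positive length) if $\Gamma$ is a ''degenerate'' Theta--network; $\overline{F}(\Gamma)=+\infty$ otherwise. *)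

(* Defs.v *)
From HB Require Import structures.
From mathcomp Require Export all_boot all_order all_algebra.
From mathcomp Require Export all_classical all_reals all_analysis.
Export Order.TTheory GRing.Theory Num.Theory.
Export numFieldNormedType.Exports.

Set Implicit Arguments.
Unset Strict Implicit.
Unset Printing Implicit Defensive.

Local Open Scope classical_set_scope.
Local Open Scope ring_scope.

(* The norm that the library puts on 'rV[R]_2 is the sup norm; lengths, speeds
   and angles need the Euclidean one. *)
Definition dot (R : realType) (u v : 'rV[R]_2) : R := \sum_(j < 2) u 0 j * v 0 j.
Definition enorm (R : realType) (u : 'rV[R]_2) : R := Num.sqrt (dot u u).
Definition angle (R : realType) (u v : 'rV[R]_2) : R :=
  acos (dot u v / (enorm u * enorm v)).

(* phi is in C^1_c(]0, 1[), extended by 0 to the whole line. *)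
Definition C1c01 (R : realType) (phi : R -> R) : Prop :=
  [/\ forall x, derivable phi x 1,
      continuous (derive1 phi) &
      exists a b : R, [/\ 0 < a, b < 1 &
        forall x, x \notin `[a, b] -> phi x = 0]].

Definition weak_derivative (R : realType) (u g : R -> R) : Prop :=
  forall phi : R -> R, C1c01 phi ->
    \int[lebesgue_measure]_(x in `[0, 1]) (u x * derive1 phi x) =
    - \int[lebesgue_measure]_(x in `[0, 1]) (g x * phi x).

Definition square_integrable (R : realType) (g : R -> R) : Prop :=
  measurable_fun (`[0, 1] : set R) g /\
  lebesgue_measure.-integrable `[0, 1] (fun x => (g x ^+ 2)%:E).

(* An element of H^2(]0, 1[; R^2): pos and vel are the continuous
   representatives on [0, 1] of the function and of its weak derivative (so
   that vel is also the classical derivative, one-sided at 0 and 1), and acc is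
   a representative of the second weak derivative. Values outside [0, 1] are
   irrelevant. *)
Record H2curve (R : realType) := MkH2curve {
  pos : R -> 'rV[R]_2;
  vel : R -> 'rV[R]_2;
  acc : R -> 'rV[R]_2;
  pos_continuous :
    forall j, {within (`[0, 1] : set R), continuous (fun x => pos x 0 j)};
  vel_continuous :
    forall j, {within (`[0, 1] : set R), continuous (fun x => vel x 0 j)};
  acc_square_integrable : forall j, square_integrable (fun x => acc x 0 j);
  pos_vel : forall j, weak_derivative (fun x => pos x 0 j) (fun x => vel x 0 j);
  vel_acc : forall j, weak_derivative (fun x => vel x 0 j) (fun x => acc x 0 j) }.

Definition curve_length (R : realType) (c : H2curve R) : R :=
  \int[lebesgue_measure]_(x in `[0, 1]) enorm (vel c x).

Definition regular (R : realType) (c : H2curve R) : Prop :=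
  forall x : R, 0 <= x <= 1 -> enorm (vel c x) != 0.

Definition tau (R : realType) (c : H2curve R) (x : R) : 'rV[R]_2 :=
  (enorm (vel c x))^-1 *: vel c x.

Record network (R : realType) := MkNetwork {
  curve : 'I_3 -> H2curve R;
  junction0 : forall i j, pos (curve i) 0 = pos (curve j) 0;
  junction1 : forall i j, pos (curve i) 1 = pos (curve j) 1;
  constant_speed : forall (i : 'I_3) (x : R), 0 <= x <= 1 ->
    enorm (vel (curve i) x) = curve_length (curve i) }.

Definition theta_network (R : realType) (G : network R) : Prop :=
  [/\ forall i, regular (curve G i),
      \sum_(i < 3) tau (curve G i) 0 = 0 &
      \sum_(i < 3) tau (curve G i) 1 = 0].

Definition degenerate_theta_network (R : realType) (G : network R) : Prop :=
  exists i j k : 'I_3, uniq [:: i; j; k] /\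
    let c1 := curve G i in let c2 := curve G j in let c3 := curve G k in
    [/\ regular c1 /\ regular c2,
        exists P : 'rV[R]_2,
          (forall x : R, 0 <= x <= 1 -> pos c3 x = P) /\
          [/\ pos c1 0 = P, pos c1 1 = P, pos c2 0 = P & pos c2 1 = P],
        angle (tau c1 0) (tau c2 0) = 2 * pi / 3 &
        [set tau c1 0; tau c2 0] = [set tau c1 1; tau c2 1]].

Definition curve_energy (R : realType) (c : H2curve R) : \bar R :=
  (((curve_length c ^+ 3)^-1)%:E *
     \int[lebesgue_measure]_(x in `[0%R, 1%R]) (enorm (acc c x) ^+ 2)%:E
   + (curve_length c)%:E)%E.

Definition Fbar (R : realType) (G : network R) : \bar R :=
  if `[< theta_network G >] then (\sum_(i < 3) curve_energy (curve G i))%E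
  else if `[< degenerate_theta_network G >] then
    (\sum_(i < 3 | (0 < curve_length (curve G i))%R) curve_energy (curve G i))%E
  else +oo%E.

Definition H2_inner (R : realType) (c d : H2curve R) : R :=
  \int[lebesgue_measure]_(x in `[0, 1])
    (dot (pos c x) (pos d x) + dot (vel c x) (vel d x) + dot (acc c x) (acc d x)).

Definition weak_H2_cvg (R : realType) (c : nat -> H2curve R) (d : H2curve R) :=
  forall e : H2curve R, (fun n => H2_inner (c n) e) @ \oo --> H2_inner d e.

(* The C^{1,alpha} norm on [0, 1] of a function u with derivative du. *)
Definition C1alpha_norm (R : realType) (alpha : R) (u du : R -> 'rV[R]_2) :
    \bar R :=
  (ereal_sup [set (enorm (u x))%:E | x in `[0%R, 1%R]] +
   ereal_sup [set (enorm (du x))%:E | x in `[0%R, 1%R]] +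
   ereal_sup [set (enorm (du p.1 - du p.2) / `|p.1 - p.2| `^ alpha)%:E |
     p in [set p : R * R | [/\ (0 <= p.1 <= 1)%R, (0 <= p.2 <= 1)%R &
                               p.1 != p.2]]])%E.

Definition strong_C1alpha_cvg (R : realType) (alpha : R)
    (c : nat -> H2curve R) (d : H2curve R) : Prop :=
  (fun n => C1alpha_norm alpha (fun x => pos (c n) x - pos d x)
              (fun x => vel (c n) x - vel d x)) @ \oo --> 0%E.

(* Main.v *)
Require Import Defs.
From mathcomp Require Import ring lra measurable_realfun.

(* The energy bound controls the lengths and gives int |gamma_xx|^2 <= C L^3, so
   the curves are bounded in H^2: positions and velocities are uniformly
   1/2-Hoelder and converge uniformly along a subsequence, hence in C^{1,alpha}
   by interpolation. For the weak limit of the second derivatives a_n, fix any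
   ultrafilter finer than \oo: the functional l g = lim int a_n g exists along
   it, and minimizing int g^2 - 2 l g represents l by a square-integrable
   function. Its integrals over the intervals [0, x] are the increments of the
   limit velocity, so it does not depend on the ultrafilter, and the convergence
   holds along \oo.

   For one curve of length L, the velocity stays within (C L^3)^(1/2) of its
   initial value, and so does the chord. A closed curve therefore cannot be
   short; neither can two curves of a Theta-network both be short, since they
   share their chord while their initial velocities form an angle of 120
   degrees. So at most one length tends to 0; the tangents of that curve at its
   two ends have the same limit, hence the two other tangents have the same sum
   at both ends, which determines the pair in the plane. *)

Set Implicit Arguments.
Unset Strict Implicit.
Unset Printing Implicit Defensive.

Local Open Scope classical_set_scope.
Local Open Scope ring_scope.

(** * Square-integrable functions on the unit interval *)

Section L2.
Variable R : realType.
Implicit Types (f g h : R -> R).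
Local Notation mu := (@lebesgue_measure R).
Local Notation I := (`[0, 1]%classic : set R).

(** Square-integrable functions are kept as plain functions, never identified almost everywhere, so
    two limits are compared only through their values of [ip] against other functions. An
    ultrafilter yields limits of all bounded quantities at once, with no dense sequence and no
    diagonal argument, but the theorem asks for a genuine subsequence: it is extracted from the
    uniform closeness of positions and velocities alone, and the accelerations then converge along
    that same subsequence. In the geometric part an ultrafilter also settles every finite choice:
    Theta or degenerate, which curve has collapsed, how the tangents at the two ends are matched.
    The short curve is handled by scaling: its velocity oscillates by at most (C L^3)^(1/2), and
    dividing by the speed L leaves (C L)^(1/2) for the unit tangent, which vanishes with L although
    the limit curve has no tangent. *)

Definition ip f g : R := \int[mu]_(x in I) (f x * g x).

Let mI : measurable I. Proof. exact: measurable_itv. Qed.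

Lemma lebesgue_I : mu I = 1%E.
Proof. by rewrite lebesgue_measure_itv/= lte_fin ltr01 -EFinB subr0. Qed.

Lemma continuous_within_measurable f : {within I, continuous f} -> measurable_fun I f.
Proof. by move=> cf; exact: subspace_continuous_measurable_fun. Qed.

Lemma sqi_mul f g : square_integrable f -> square_integrable g ->
  mu.-integrable I (fun x => (f x * g x)%:E).
Proof.
move=> [mf if2] [mg ig2].
apply: (@le_integrable _ _ _ mu I mI _ (fun x => ((f x ^+ 2)%:E + (g x ^+ 2)%:E)%E)).
- apply/measurable_EFinP; exact: measurable_funM.
- move=> x _; rewrite -EFinD !abse_EFin lee_fin.
  rewrite [leRHS]ger0_norm ?addr_ge0 ?sqr_ge0// normrM.
  rewrite -(real_normK (num_real (f x))) -(real_normK (num_real (g x))).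
  have := sqr_ge0 (`|f x| - `|g x|); nra.
- exact: integrableD.
Qed.

Lemma sqi_continuous f : {within I, continuous f} -> square_integrable f.
Proof.
move=> cf; split; first exact: continuous_within_measurable.
apply: continuous_compact_integrable; first exact: segment_compact.
move=> x; apply: cvgM; exact: cf.
Qed.

Lemma sqi_cst (c : R) : square_integrable (fun=> c).
Proof. by apply: sqi_continuous; apply: continuous_subspaceT => x; exact: cvg_cst. Qed.

Lemma sqi_integrable f : square_integrable f -> mu.-integrable I (EFin \o f).
Proof.
move=> sf; have := sqi_mul sf (sqi_cst 1).
by apply: eq_integrable => // x _; rewrite /= mulr1.
Qed.

Lemma sqiZ c f : square_integrable f -> square_integrable (fun x => c * f x).
Proof.
move=> [mf if2]; split; first exact: measurable_funM.
have := @integrableZl _ _ _ mu I mI (c ^+ 2) _ if2.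
by apply: eq_integrable => // x _; rewrite /= exprMn.
Qed.

Lemma sqiD f g : square_integrable f -> square_integrable g ->
  square_integrable (fun x => f x + g x).
Proof.
move=> sf sg; have [mf if2] := sf; have [mg ig2] := sg.
split; first exact: measurable_funD.
have H := @integrableD _ _ _ mu I mI _ _ (@integrableD _ _ _ mu I mI _ _ if2 ig2)
  (@integrableZl _ _ _ mu I mI 2 _ (sqi_mul sf sg)).
apply: eq_integrable H => // x _.
rewrite /= -!EFinD; congr EFin; ring.
Qed.

Lemma sqiB f g : square_integrable f -> square_integrable g ->
  square_integrable (fun x => f x - g x).
Proof.
move=> sf sg; have := sqiD sf (sqiZ (-1) sg).
by under eq_fun do rewrite mulN1r.
Qed.

Lemma sqi_indic (A : set R) : measurable A -> square_integrable (\1_A : R -> R).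
Proof.
move=> mA; have mi : measurable_fun I (\1_A : R -> R) by exact: measurable_indic.
split=> //.
apply: (@le_integrable _ _ _ mu I mI _ (cst 1%E)).
- by apply/measurable_EFinP; exact: measurable_funX.
- move=> x _; rewrite !abse_EFin lee_fin indicE.
  by case: (x \in A); rewrite ?expr1n ?normr1// expr0n normr0.
- have := sqi_integrable (sqi_cst 1); exact.
Qed.

Lemma ipC f g : ip f g = ip g f.
Proof. by rewrite /ip; under eq_Rintegral do rewrite mulrC. Qed.

Lemma ipDl f g h : square_integrable f -> square_integrable g -> square_integrable h ->
  ip (fun x => f x + g x) h = ip f h + ip g h.
Proof.
move=> sf sg sh; rewrite /ip -RintegralD//; [|exact: sqi_mul|exact: sqi_mul].
by apply: eq_Rintegral => x _; rewrite mulrDl.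
Qed.

Lemma ipZl c f h : square_integrable f -> square_integrable h ->
  ip (fun x => c * f x) h = c * ip f h.
Proof.
move=> sf sh; rewrite /ip -RintegralZl//; last exact: sqi_mul.
by apply: eq_Rintegral => x _; rewrite mulrA.
Qed.

Lemma ipBl f g h : square_integrable f -> square_integrable g -> square_integrable h ->
  ip (fun x => f x - g x) h = ip f h - ip g h.
Proof.
move=> sf sg sh; rewrite /ip -RintegralB//; [|exact: sqi_mul|exact: sqi_mul].
by apply: eq_Rintegral => x _; rewrite mulrBl.
Qed.

Lemma ipDr f g h : square_integrable f -> square_integrable g -> square_integrable h ->
  ip h (fun x => f x + g x) = ip h f + ip h g.
Proof. by move=> sf sg sh; rewrite ipC ipDl// !(ipC h). Qed.

Lemma ipZr c f h : square_integrable f -> square_integrable h ->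
  ip h (fun x => c * f x) = c * ip h f.
Proof. by move=> sf sh; rewrite ipC ipZl// (ipC h). Qed.

Lemma ipBr f g h : square_integrable f -> square_integrable g -> square_integrable h ->
  ip h (fun x => f x - g x) = ip h f - ip h g.
Proof. by move=> sf sg sh; rewrite ipC ipBl// !(ipC h). Qed.

Lemma ip_ge0 f : 0 <= ip f f.
Proof. by apply: Rintegral_ge0 => x _; rewrite -expr2 sqr_ge0. Qed.

Lemma ipE f : square_integrable f ->
  (\int[mu]_(x in I) (f x ^+ 2)%:E = (ip f f)%:E)%E.
Proof.
move=> [mf if2]; rewrite /ip /Rintegral; under [in RHS]eq_integral do rewrite -expr2.
by rewrite fineK//; exact: integrable_fin_num.
Qed.

(** The discriminant of a nonnegative quadratic. It serves twice: for Cauchy-Schwarz and, in the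
    Riesz argument, to bound the first variation at an almost minimizer. *)
Lemma quadratic_ge0 (a b c : R) : (forall t : R, 0 <= a + 2 * t * b + t ^+ 2 * c) ->
  b ^+ 2 <= a * c.
Proof.
move=> H.
have c0 : 0 <= c.
  rewrite leNgt; apply/negP => cN.
  have a0 : 0 <= a by have := H 0; rewrite mulr0 mul0r expr0n mul0r !addr0.
  (* At t = 1 + s the product s * c absorbs a + 2 |b| + 1, and the quadratic becomes negative. *)
  pose s := (a + 2 * `|b| + 1) / (- c).
  have s0 : 0 < s by rewrite divr_gt0 ?oppr_gt0// ltr_wpDl// addr_ge0// mulr_ge0.
  have sc : s * c = - (a + 2 * `|b| + 1) by rewrite /s; field; rewrite lt_eqF.
  have := H (1 + s); have := ler_norm b; have := ler_norm (- b).
  rewrite normrN; set B := `|b| in sc *; nra.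
have [c00|cn0] := eqVneq c 0.
  have [->|bn0] := eqVneq b 0; first by rewrite expr0n c00 mulr0.
  (* With c = 0 the quadratic is affine in t; this t gives it the value -1. *)
  exfalso; have := H (- (a + 1) / (2 * b)).
  rewrite c00 mulr0 addr0.
  have -> : 2 * (- (a + 1) / (2 * b)) * b = - (a + 1) by field.
  by lra.
have cp : 0 < c by rewrite lt_def cn0.
have := H (- b / c).
have -> : a + 2 * (- b / c) * b + (- b / c) ^+ 2 * c = (a * c - b ^+ 2) / c by field.
by rewrite pmulr_lge0 ?invr_gt0// subr_ge0.
Qed.

Lemma ip_cauchy_schwarz f g : square_integrable f -> square_integrable g ->
  ip f g ^+ 2 <= ip f f * ip g g.
Proof.
move=> sf sg; apply: quadratic_ge0 => t.
have sh := sqiD sf (sqiZ t sg).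
have := ip_ge0 (fun x => f x + t * g x).
have stg := sqiZ t sg.
rewrite ipDl// !ipDr// !ipZl// !ipZr//.
rewrite (ipC g f); by nra.
Qed.

End L2.

(** * Completeness of L2 on the unit interval *)

Section L2complete.
Variable R : realType.
Implicit Types (f g h : R -> R).
Local Notation mu := (@lebesgue_measure R).
Local Notation I := (`[0, 1]%classic : set R).
Let mI : measurable I. Proof. exact: measurable_itv. Qed.

Lemma geometric_increments (u : nat -> R) (s : R) :
  (forall j, `|u j.+1 - u j| <= s / 2 ^+ j) ->
  exists2 l, u @ \oo --> l & forall j, `|l - u j| <= 2 * s / 2 ^+ j.
Proof.
move=> us.
have s0 : 0 <= s by have := le_trans (normr_ge0 _) (us 0%N); rewrite expr0 divr1.
(* Subtracting the remaining tail is what makes the induction on m close. *)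
have H j m : `|u (j + m)%N - u j| <= 2 * s / 2 ^+ j - 2 * s / 2 ^+ (j + m).
  elim: m => [|m IH]; first by rewrite addn0 !subrr normr0.
  rewrite addnS; have := us (j + m)%N.
  have -> : 2 * s / 2 ^+ (j + m).+1 = s / 2 ^+ (j + m).
    by rewrite exprS; field; rewrite expf_neq0.
  have := ler_normD (u (j + m).+1 - u (j + m)%N) (u (j + m)%N - u j).
  rewrite addrA subrK.
  move: IH; have -> : 2 * s / 2 ^+ (j + m) = s / 2 ^+ (j + m) + s / 2 ^+ (j + m) by field; rewrite expf_neq0.
  lra.
have H' j k : (j <= k)%N -> `|u k - u j| <= 2 * s / 2 ^+ j.
  move=> jk; rewrite -(subnKC jk); apply: le_trans (H _ _) _.
  by rewrite gerBl divr_ge0 ?mulr_ge0// exprn_ge0.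
have : cvg (u @ \oo).
  apply: cauchy_cvg; apply: cauchy_exP => e e0.
  have /cvgrPdist_lt/(_ e e0) : (fun n => 2 * s * (2^-1) ^+ n) @ \oo --> (2 * s * 0 : R).
    by apply: cvgMr; apply: cvg_expr; rewrite gtr0_norm ?invr_gt0// invf_lt1// ltr1n.
  move=> [N _ /(_ N (leqnn N))]; rewrite /= mulr0 sub0r normrN => HN.
  exists (u N); exists N => // k Nk; rewrite /ball/= distrC.
  apply: le_lt_trans (H' _ _ Nk) _; apply: le_lt_trans HN.
  by rewrite exprVn ler_norm.
move=> /cvg_ex[l ul]; exists l => // j.
have ulj : (fun n => `|u n - u j|) @ \oo --> `|l - u j|.
  by apply: cvg_norm; apply: cvgB => //; exact: cvg_cst.
apply: (cvgr_to_le ulj).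
by exists j => // k; exact: H'.
Qed.

(** Riesz-Fischer with a rate. The bounds 1 / 2^(j+1) sum to 1, so the weighted sum [T] of the 4^j
    d_j^2 has integral at most 1. Where [T] is finite, |d_j| <= sqrt(T) / 2^j: the sequence
    converges geometrically, with (g - f_j)^2 <= (4 / 4^j) T, and integrating this gives the
    conclusion. *)
Lemma sqi_complete (f : nat -> R -> R) :
  (forall j, square_integrable (f j)) ->
  (forall j, 4 ^+ j * ip (fun x => f j.+1 x - f j x) (fun x => f j.+1 x - f j x)
     <= 1 / (2 ^ j.+1)%:R) ->
  exists2 g, square_integrable g &
    forall j, ip (fun x => g x - f j x) (fun x => g x - f j x) <= 4 / 4 ^+ j.
Proof.
move=> sf fd.
have mf j : measurable_fun I (f j) by have [] := sf j.
pose d j x := f j.+1 x - f j x.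
have sd j : square_integrable (d j) by exact: sqiB.
pose w j x : \bar R := (4 ^+ j * (d j x) ^+ 2)%:E.
have w0 j x : (0 <= w j x)%E by rewrite lee_fin mulr_ge0 ?sqr_ge0// exprn_ge0.
have mw j : measurable_fun I (w j).
  apply/measurable_EFinP; apply: measurable_funM => //; apply: measurable_funX.
  by have [] := sd j.
pose T x : \bar R := (\sum_(0 <= j <oo) w j x)%E.
have mT : measurable_fun I T.
  exact: (@ge0_emeasurable_sum _ _ R I w xpredT (fun k x _ _ => w0 k x) (fun k _ => mw k)).
have T0 x : (0 <= T x)%E by apply: nneseries_ge0 => *; exact: w0.
have iT : (\int[mu]_(x in I) T x <= 1)%E.
  rewrite integral_nneseries//.
  apply: le_trans (@epsilon_trick0 R 1 xpredT ler01).
  apply: lee_nneseries => j *; first exact: integral_ge0.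
  rewrite /w; under eq_integral do rewrite EFinM.
  rewrite ge0_integralZl_EFin; [|by []|by move=> x _; rewrite lee_fin sqr_ge0| |by rewrite exprn_ge0]; last first.
    by apply/measurable_EFinP; apply: measurable_funX; have [] := sd j.
  by rewrite ipE// -EFinM lee_fin; exact: fd.
have wT j x t : T x = t%:E -> 4 ^+ j * (d j x) ^+ 2 <= t.
  move=> Tx; rewrite -lee_fin -Tx.
  have := @nneseries_lim_ge R (fun j => w j x) xpredT 0%N j.+1 (fun k _ _ => w0 k x).
  apply: le_trans; rewrite big_nat_recr//= leeDr//.
  by apply: sume_ge0.
have two4 k : (2 ^+ k) ^+ 2 = 4 ^+ k :> R.
  by rewrite -exprM mulnC exprM -natrX.
(* limn_esup instead of lim: measurable also where the sequence diverges *)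
pose g x := fine (limn_esup (fun n => (f n x)%:E)).
have mg : measurable_fun I g.
  apply: measurableT_comp => //; apply: measurable_fun_limn_esup => n.
  exact/measurable_EFinP.
(* trivial where T x = +oo, so no almost-everywhere argument is needed *)
have gT j x : (((g x - f j x) ^+ 2)%:E <= (4 / 4 ^+ j)%:E * T x)%E.
  have c0 : 0 < 4 / 4 ^+ j :> R by rewrite divr_gt0// exprn_gt0.
  have [Tfin|] := boolP (T x \is a fin_num); last first.
    rewrite ge0_fin_numE// -leNgt leye_eq => /eqP ->.
    by rewrite gt0_muley ?lte_fin// leey.
  pose t := fine (T x).
  have Tt : T x = t%:E by rewrite /t fineK.
  have t0 : 0 <= t by rewrite fine_ge0.
  have [l fl fj] : exists2 l, f ^~ x @ \oo --> l &
      forall j, `|l - f j x| <= 2 * Num.sqrt t / 2 ^+ j.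
    apply: geometric_increments => k.
    rewrite ler_pdivlMr ?exprn_gt0// -ler_sqr ?nnegrE ?mulr_ge0 ?sqrtr_ge0//.
    rewrite sqr_sqrtr// exprMn real_normK ?num_real// mulrC two4.
    exact: wT.
  have -> : g x = l.
    have fle : (fun n => (f n x)%:E) @ \oo --> l%:E by apply: cvg_EFin; [exact: nearW|].
    by rewrite /g (cvg_limn_einf_sup fle).2.
  rewrite Tt -EFinM lee_fin -(real_normK (num_real _)).
  apply: le_trans (_ : (2 * Num.sqrt t / 2 ^+ j) ^+ 2 <= _).
    by rewrite ler_sqr ?nnegrE ?divr_ge0 ?mulr_ge0 ?sqrtr_ge0// exprn_ge0.
  have -> // : (2 * Num.sqrt t / 2 ^+ j) ^+ 2 = 4 / 4 ^+ j * t.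
  rewrite -two4 -{2}(sqr_sqrtr t0) -(expr1 4) -two4; field; exact: expf_neq0.
have igf j : (\int[mu]_(x in I) ((g x - f j x) ^+ 2)%:E <= (4 / 4 ^+ j)%:E)%E.
  have mgf : measurable_fun I (fun x => ((g x - f j x) ^+ 2)%:E).
    by apply/measurable_EFinP; apply: measurable_funX; exact: measurable_funB.
  have c0 : 0 <= 4 / 4 ^+ j :> R by rewrite divr_ge0// exprn_ge0.
  apply: le_trans (_ : \int[mu]_(x in I) ((4 / 4 ^+ j)%:E * T x) <= _)%E.
    apply: ge0_le_integral => //.
    - by move=> x _; rewrite lee_fin sqr_ge0.
    - exact: measurable_funeM.
  rewrite ge0_integralZl_EFin// -[leRHS]mule1.
  by rewrite lee_wpmul2l.
have sgf j : square_integrable (fun x => g x - f j x).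
  have mgf : measurable_fun I (fun x => g x - f j x) by exact: measurable_funB.
  have mgf2 : measurable_fun I (fun x => (g x - f j x) ^+ 2) by exact: measurable_funX.
  split => //; apply/integrableP; split; first exact/measurable_EFinP.
  under eq_integral do rewrite /= ger0_norm ?sqr_ge0//.
  exact: le_lt_trans (igf j) (ltry _).
exists g; last by move=> j; rewrite -lee_fin -ipE//.
have := sqiD (sgf 0%N) (sf 0%N).
by under eq_fun do rewrite subrK.
Qed.

End L2complete.

(** * Weak compactness in L2 *)

Section riesz.
Variable R : realType.
Implicit Types (f g h : R -> R).
Local Notation mu := (@lebesgue_measure R).
Local Notation I := (`[0, 1]%classic : set R).
Let mI : measurable I. Proof. exact: measurable_itv. Qed.

Lemma le0_geometric (x c : R) : (forall j, x <= c / 4 ^+ j) -> x <= 0.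
Proof.
move=> H.
have cl : (fun n => c * (4^-1) ^+ n) @ \oo --> (c * 0 : R).
  by apply: cvgMr; apply: cvg_expr; rewrite gtr0_norm ?invr_gt0// invf_lt1// ltr1n.
rewrite -(mulr0 c); apply: (cvgr_to_ge cl).
by apply: nearW => j; rewrite exprVn.
Qed.

(** Boundedness below of ip g g - 2 l g stands in for continuity of [l]: Young's inequality provides
    it directly for a limit of inner products. Linearity is asked on square-integrable functions
    only. *)
Lemma riesz_bounded_below (l : (R -> R) -> R) (K : R) :
  (forall f g, square_integrable f -> square_integrable g ->
     l (fun x => f x + g x) = l f + l g) ->
  (forall c f, square_integrable f -> l (fun x => c * f x) = c * l f) ->
  (forall g, square_integrable g -> - K <= ip g g - 2 * l g) ->
  exists2 a, square_integrable a & forall g, square_integrable g -> l g = ip a g.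
Proof.
move=> lD lZ lK.
pose J g := ip g g - 2 * l g.
pose S := [set J g | g in @square_integrable R].
have infS : has_inf S.
  split; first by exists (J (fun=> 0)); exists (fun=> 0) => //; exact: sqi_cst.
  by exists (- K) => _ [g sg <-]; exact: lK.
pose m := inf S.
have mJ g : square_integrable g -> m <= J g.
  by move=> sg; apply: ge_inf; [exact: infS.2|exists g].
(* Chosen so that 4 * e j = 1 / (2^(j+1) 4^j), the decay that [sqi_complete] asks of consecutive
   differences; it decreases, so [G j] and [G j.+1] are both within [e j] of the infimum. *)
pose e j : R := 1 / (4 ^+ j * (2 ^ j.+1)%:R * 4).
have e0 j : 0 < e j by rewrite divr_gt0// !mulr_gt0// ?exprn_gt0// ltr0n expn_gt0.
have eS j : e j.+1 <= e j.
  rewrite /e !div1r lef_pV2 ?posrE ?mulr_gt0 ?exprn_gt0 ?ltr0n ?expn_gt0//.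
  rewrite ler_pM2r// ler_pM ?exprn_ge0// ?exprS ?ler_nat ?leq_exp2l//.
  by rewrite ler_peMl ?exprn_ge0// ler1n.
have e4 j : 4 * e j = (1 / (2 ^ j.+1)%:R) / 4 ^+ j.
  have h1 : (2 ^ j.+1)%:R != 0 :> R by rewrite pnatr_eq0 -lt0n expn_gt0.
  have h2 : 4 ^+ j != 0 :> R by rewrite expf_neq0.
  by rewrite /e; field; rewrite h2 h1.
have e4' j : e j <= 1 / 4 ^+ j.
  rewrite /e !div1r lef_pV2 ?posrE ?mulr_gt0 ?exprn_gt0 ?ltr0n ?expn_gt0//.
  rewrite -mulrA -natrM ler_peMr ?exprn_ge0// ler1n muln_gt0 expn_gt0//.
have /choice[G HG] : forall j, exists g, square_integrable g /\ J g < m + e j.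
  move=> j; have [_ [g sg <-] Jg] := inf_adherent (e0 j) infS.
  by exists g.
have sG j : square_integrable (G j) := (HG j).1.
(* parallelogram identity: a minimizing sequence is Cauchy *)
have GD j : ip (fun x => G j.+1 x - G j x) (fun x => G j.+1 x - G j x) <= 4 * e j.
  have sg := sG j; have sh := sG j.+1.
  move: (G j) (G j.+1) (HG j).2 (HG j.+1).2 (eS j) sg sh => g h Jg Jh es sg sh.
  have sgh := sqiD sg sh.
  have := mJ _ (sqiZ (1 / 2) sgh).
  have sz := sqiZ (1 / 2) sgh; have sb := sqiB sh sg.
  rewrite /J lZ// lD// ipBl// !ipBr// ipZl// ipZr// ipDl// !ipDr//.
  move: Jg Jh; rewrite /J (ipC h g); lra.
have [a sa Ha] : exists2 g, square_integrable g &
    forall j, ip (fun x => g x - G j x) (fun x => g x - G j x) <= 4 / 4 ^+ j.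
  apply: sqi_complete => // j.
  rewrite mulrC -ler_pdivlMr ?exprn_gt0//; apply: le_trans (GD j) _.
  by rewrite e4.
exists a => // g sg.
apply/eqP; rewrite -subr_eq0 -sqrf_eq0 eq_le sqr_ge0 andbT.
(* 10 = 2 * 4 + 2 * 1, from (x + y)^2 <= 2 x^2 + 2 y^2 and the bounds 4 / 4^j and 1 / 4^j on the two
   squares. *)
apply: (@le0_geometric _ (10 * ip g g)) => j.
(* J (G j + t g) >= m for every t while J (G j) < m + e j, so a quadratic in t is nonnegative; its
   discriminant bounds the first variation. *)
have H1 : (ip (G j) g - l g) ^+ 2 <= e j * ip g g.
  apply: quadratic_ge0 => t.
  have stg := sqiZ t sg.
  have := mJ _ (sqiD (sG j) stg); have := (HG j).2; have := sG j.
  rewrite /J => sGj; have sd := sqiD sGj stg.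
  rewrite lD// lZ// ipDl// !ipDr// !ipZl// !ipZr// (ipC g (G j)).
  by nra.
have H2 : (ip a g - ip (G j) g) ^+ 2 <= 4 / 4 ^+ j * ip g g.
  rewrite -ipBl//; apply: le_trans (ip_cauchy_schwarz (sqiB sa (sG j)) sg) _.
  by rewrite ler_wpM2r ?ip_ge0.
have H3 : e j * ip g g <= 1 / 4 ^+ j * ip g g by rewrite ler_wpM2r ?ip_ge0.
have := sqr_ge0 ((ip a g - ip (G j) g) - (ip (G j) g - l g)).
have -> : 10 * ip g g / 4 ^+ j = 2 * (4 / 4 ^+ j * ip g g) + 2 * (1 / 4 ^+ j * ip g g).
  by field; rewrite expf_neq0.
by nra.
Qed.

Lemma Rintegral_indic f (x y : R) : 0 <= x -> y <= 1 ->
  \int[mu]_(t in `[x, y]) f t = ip f (\1_(`[x, y]%classic : set R)).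
Proof.
move=> x0 y1.
have -> : `[x, y]%classic = I `&` `[x, y]%classic.
  apply/seteqP; split => t /=; last by case.
  rewrite !in_itv/= => /andP[xt ty]; split; last by rewrite xt.
  by rewrite (le_trans x0 xt) (le_trans ty y1).
rewrite Rintegral_mkcondr; apply: eq_Rintegral => t; rewrite inE => It.
rewrite patchE indicE in_setI (mem_set It)/=.
by case: ifP => _; rewrite ?mulr1 ?mulr0.
Qed.

(** Extended by zero, f has a primitive that vanishes identically, so f = 0 almost everywhere by
    Lebesgue differentiation. *)
Lemma ip_eq0 f : square_integrable f ->
  (forall x, 0 <= x <= 1 -> \int[mu]_(t in `[0, x]) f t = 0) ->
  forall g, square_integrable g -> ip f g = 0.
Proof.
move=> sf f0 g sg.
pose b := f \_ I.
have ib : mu.-integrable setT (EFin \o b).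
  rewrite /b -restrict_EFin -integrable_mkcond//; exact: sqi_integrable.
have ib' (D : set R) : measurable D -> mu.-integrable D (EFin \o b).
  by move=> mD; exact: integrableS ib.
have ftc := @FTC1Ny R b (fun y => ib' _ (measurable_itv _)) (integrable_locally mI (sqi_integrable sf)).
have F0 y : \int[mu]_(t in [set` `]-oo, y]]) b t = 0.
  rewrite /b -Rintegral_mkcondr.
  have [y0|y0] := ltP y 0.
    rewrite (_ : _ `&` _ = set0) ?Rintegral_set0//.
    apply/seteqP; split => t //=; rewrite !in_itv/= => -[ty /andP[t0 _]].
    by have := le_lt_trans (le_trans t0 ty) y0; rewrite ltxx.
  have -> : [set` `]-oo, y]] `&` I = `[0, Num.min y 1]%classic.
    apply/seteqP; split => t /=; rewrite !in_itv/= le_min.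
      by case=> -> /andP[-> ->].
    by move=> /andP[-> /andP[-> ->]].
  by apply: f0; rewrite le_min y0 ler01 ge_min lexx orbT.
rewrite /ip /Rintegral (_ : \int[mu]_(x in I) (f x * g x)%:E = 0)%E//.
have mfg : measurable_fun I (EFin \o (fun x => f x * g x)).
  by have /integrableP[] := sqi_mul sf sg.
rewrite (_ : 0 = \int[mu]_(x in I) cst 0 x)%E; last by rewrite integral0.
apply: ae_eq_integral => //.
apply: filterS ftc; first exact: (ae_filter_ringOfSetsType mu).
move=> x /= [_ dF] Ix.
have : b x = 0.
  rewrite -dF (_ : (fun _ => _) = cst 0); first by rewrite derive1_cst.
  by apply/funext => y; rewrite F0.
rewrite /b patchE mem_set// => ->.
by rewrite mul0r.
Qed.

(** Compactness gives a cluster point, and a cluster point of an ultrafilter is a limit. *)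
Lemma ultra_bounded_cvg (U : set_system nat) (u : nat -> R) (M : R) :
  UltraFilter U -> (forall n, `|u n| <= M) -> exists l : R, u @ U --> l.
Proof.
move=> UU uM.
have [l [_ ul]] : `[- M, M]%classic `&` cluster (u @ U) !=set0.
  apply: segment_compact; apply: (@filterE _ U) => n /=.
  by rewrite in_itv/= -ler_norml.
exists l => B Bl.
have [//|UB] := in_ultra_setVsetC (u @^-1` B) UU.
exfalso; have [z [/= zB zNB]] := ul (~` B) B UB Bl.
exact: zB.
Qed.

(** If the preimage of a neighbourhood B of l is not in F, then F is compatible with the complement
    of that preimage, and an ultrafilter containing both contradicts the hypothesis. *)
Lemma cvg_ultra (T : Type) (V : topologicalType) (F : set_system T) (f : T -> V) (l : V) :
  Filter F ->
  (forall U, UltraFilter U -> F `<=` U -> f @ U --> l) -> f @ F --> l.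
Proof.
move=> FF H B Bl; apply: contrapT => nFB.
have {}nFB : ~ F (f @^-1` B) by [].
have PG : ProperFilter (within (~` (f @^-1` B)) F).
  apply: Build_ProperFilter_ex => P wP; apply: contrapT => nP; apply: nFB.
  have {}wP : F [set x | ~ B (f x) -> P x] by exact: wP.
  by apply: filterS wP => x Px; apply: contrapT => Bx; apply: nP; exists x; exact: Px.
have [U [UU GU]] := ultraFilterLemma PG.
have UF : F `<=` U by move=> A FA; apply: GU; exact: (@cvg_within _ F FF _ A FA).
have UN : U (~` (f @^-1` B)) by apply: GU; exact: withinT.
have UB : U (f @^-1` B) by exact: (H U UU UF).
have /filter_ex[x [/= a b]] : U ((f @^-1` B) `&` ~` (f @^-1` B)) by exact: filterI.
exact: b.
Qed.

Lemma ip_young f g : square_integrable f -> square_integrable g ->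
  2 * ip f g <= ip f f + ip g g.
Proof.
move=> sf sg; have := ip_ge0 (fun x => f x - g x).
have sb := sqiB sf sg.
by rewrite ipBl// !ipBr// (ipC g f); lra.
Qed.

Lemma weak_L2_compactness (a : nat -> R -> R) (K : R) (W : R -> R) :
  (forall n, square_integrable (a n)) -> (forall n, ip (a n) (a n) <= K) ->
  (forall x, 0 <= x <= 1 -> (fun n => \int[mu]_(t in `[0, x]) a n t) @ \oo --> W x) ->
  exists2 b, square_integrable b &
    forall g, square_integrable g -> (fun n => ip (a n) g) @ \oo --> ip b g.
Proof.
move=> sa aK aW.
have ultra (U : set_system nat) : UltraFilter U -> \oo `<=` U ->
    exists2 b, square_integrable b & (forall g, square_integrable g ->
      (fun n => ip (a n) g) @ U --> ip b g) /\
      (forall x, 0 <= x <= 1 -> \int[mu]_(t in `[0, x]) b t = W x).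
  move=> UU Uoo.
  pose l g := lim ((fun n => ip (a n) g) @ U).
  have lE g : square_integrable g -> (fun n => ip (a n) g) @ U --> l g.
    move=> sg; apply/cvg_ex; apply: (@ultra_bounded_cvg _ _ (K + ip g g)) => // n.
    have H1 := ip_young (sa n) sg; have H2 := ip_young (sa n) (sqiZ (-1) sg).
    have := aK n; have := ip_ge0 (a n); have := ip_ge0 g; move: H2.
    have sz := sqiZ (-1) sg.
    rewrite ipZl// !ipZr//.
    by move: H1; rewrite ler_norml; nra.
  have [b sb lb] : exists2 b, square_integrable b &
      forall g, square_integrable g -> l g = ip b g.
    apply: (@riesz_bounded_below l K).
    - move=> f g sf sg; apply/cvg_lim; first exact: Rhausdorff.
      under eq_fun do rewrite ipDr//.
      by apply: cvgD; exact: lE.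
    - move=> c f sf; apply/cvg_lim; first exact: Rhausdorff.
      under eq_fun do rewrite ipZr//.
      by apply: cvgMr; exact: lE.
    (* The lower bound is -K because 2 ip (a n) g <= K + ip g g passes to the limit. *)
    - move=> g sg; suff : 2 * l g <= K + ip g g by lra.
      have l2 : (fun n => 2 * ip (a n) g) @ U --> 2 * l g by apply: cvgMr; exact: lE.
      apply: (cvgr_to_le l2); apply: nearW => n /=.
      have := ip_young (sa n) sg; have := aK n; lra.
  have bg g : square_integrable g -> (fun n => ip (a n) g) @ U --> ip b g.
    by move=> sg; rewrite -lb//; exact: lE.
  exists b => //; split=> // x /andP[x0 x1].
  rewrite Rintegral_indic//.
  have six : square_integrable (\1_(`[0, x]%classic : set R) : R -> R).
    by apply: sqi_indic; exact: measurable_itv.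
  apply: (@cvg_unique _ _ (fmap (fun n => ip (a n) \1_(`[0, x]%classic : set R)) U)).
  - exact: Rhausdorff.
  - exact: bg.
  - apply: cvg_trans (cvg_app _ Uoo) _.
    have := aW x; rewrite x0 x1 => /(_ isT).
    by under eq_fun do rewrite Rintegral_indic//.
have [U0 [UU0 U0oo]] := ultraFilterLemma (eventually_filter : ProperFilter \oo).
have [b sb [bg bW]] := ultra U0 UU0 U0oo.
exists b => // g sg; apply: cvg_ultra => U UU Uoo.
have [b' sb' [b'g b'W]] := ultra U UU Uoo.
suff -> : ip b g = ip b' g by exact: b'g.
apply/eqP; rewrite -subr_eq0 -ipBl//; apply/eqP; apply: ip_eq0 => //; first exact: sqiB.
move=> x /[dup] x01 /andP[x0 x1]; rewrite Rintegral_indic// ipBl//.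
  by rewrite -!Rintegral_indic// bW// b'W// subrr.
by apply: sqi_indic; exact: measurable_itv.
Qed.

End riesz.

(** * Weak derivatives *)

Section smoothstep.
Variable R : realType.
Implicit Types (f g u : R -> R).
Local Notation mu := (@lebesgue_measure R).
Local Notation I := (`[0, 1]%classic : set R).

(** A remainder of order h^2 gives differentiability with no case distinction at the kinks of the
    absolute value. *)
Lemma is_derive1_quadratic f (t d c : R) :
  (forall h, `|f (t + h) - f t - d * h| <= c * h ^+ 2) -> is_derive t 1 f d.
Proof.
move=> H.
have cv : (fun h => h^-1 *: (f (h *: 1 + t) - f t)) @ 0^' --> d.
  apply/cvgrPdist_le => e e0; near=> h.
  have h0 : h != 0 by near: h; exact: nbhs_dnbhs_neq.
  have -> : h *: 1 = h by rewrite /GRing.scale/= mulr1.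
  have -> : d - h^-1 *: (f (h + t) - f t) = - (h^-1 * (f (t + h) - f t - d * h)).
    by rewrite /GRing.scale/= (addrC h); field.
  rewrite normrN normrM normfV ler_pdivrMl ?normr_gt0//.
  apply: le_trans (H h) _; rewrite -(real_normK (num_real h)) expr2 mulrA mulrC.
  rewrite ler_wpM2l//; apply: le_trans (_ : (`|c| + 1) * `|h| <= _).
    by rewrite ler_wpM2r// (le_trans (ler_norm c))// lerDl.
  rewrite mulrC -ler_pdivlMr ?ltr_wpDl//.
  near: h; apply: dnbhs0_le; rewrite divr_gt0// ltr_wpDl//.
split; first by apply/cvg_ex; exists d.
by apply/cvg_lim; [exact: Rhausdorff|exact: cv].
Unshelve. all: by end_near. Qed.

(* A C^1 step from 0 to 1 on [0, 1], the primitive of the tent of mass 1; writing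
   it with t |t| makes its second-order remainder explicit. *)
Definition smoothstep (t : R) : R :=
  1 / 2 + t * `|t| - 2 * ((t - 1 / 2) * `|t - 1 / 2|) + (t - 1) * `|t - 1|.

(** A second difference of the absolute value: a hat supported on [0, 1], of height 2 at 1/2. *)
Definition tent (t : R) : R := 2 * (`|t| - 2 * `|t - 1 / 2| + `|t - 1|).

(** The derivative 2 |t| of t |t| is 2-Lipschitz. *)
Let mulr_norm_quadratic (t h : R) :
  `|(t + h) * `|t + h| - t * `|t| - 2 * `|t| * h| <= h ^+ 2.
Proof.
rewrite ler_norml; have [t0|t0] := leP 0 t; have [th|th] := leP 0 (t + h).
- by rewrite (ger0_norm t0) (ger0_norm th); nra.
- by rewrite (ger0_norm t0) (ltr0_norm th); nra.
- by rewrite (ltr0_norm t0) (ger0_norm th); nra.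
- by rewrite (ltr0_norm t0) (ltr0_norm th); nra.
Qed.

(** The three terms of [smoothstep] enter with weights 1, 2 and 1, whence the constant 4. *)
Lemma smoothstep_quadratic (t h : R) :
  `|smoothstep (t + h) - smoothstep t - tent t * h| <= 4 * h ^+ 2.
Proof.
have := mulr_norm_quadratic t h; have := mulr_norm_quadratic (t - 1 / 2) h.
have := mulr_norm_quadratic (t - 1) h.
rewrite /smoothstep /tent !(addrAC _ _ h).
by rewrite !ler_norml; nra.
Qed.

Lemma smoothstep_le0 t : t <= 0 -> smoothstep t = 0.
Proof.
move=> t0; rewrite /smoothstep !ler0_norm; [by field|lra|lra|lra].
Qed.

Lemma smoothstep_ge1 t : 1 <= t -> smoothstep t = 1.
Proof.
move=> t0; rewrite /smoothstep !ger0_norm; [by field|lra|lra|lra].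
Qed.

Lemma smoothstep_ge0_le1 t : 0 <= smoothstep t <= 1.
Proof.
have [t0|t0] := leP t 0; first by rewrite smoothstep_le0// lexx ler01.
have [t1|t1] := leP 1 t; first by rewrite smoothstep_ge1// lexx ler01.
rewrite /smoothstep (gtr0_norm t0) (@ltr0_norm _ (t - 1)); last lra.
by have [h|h] := leP 0 (t - 1 / 2); [rewrite ger0_norm//|rewrite ltr0_norm//]; nra.
Qed.

Lemma tent_ge0 t : 0 <= tent t.
Proof.
rewrite /tent; have [a|a] := leP 0 t; have [b|b] := leP 0 (t - 1 / 2);
  have [c|c] := leP 0 (t - 1); rewrite ?(ger0_norm a) ?(ltr0_norm a)
  ?(ger0_norm b) ?(ltr0_norm b) ?(ger0_norm c) ?(ltr0_norm c); lra.
Qed.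

Lemma tent_le0 t : t <= 0 -> tent t = 0.
Proof.
move=> t0; rewrite /tent !ler0_norm; [by field|lra|lra|lra].
Qed.

Lemma tent_ge1 t : 1 <= t -> tent t = 0.
Proof.
move=> t0; rewrite /tent !ger0_norm; [by field|lra|lra|lra].
Qed.

Lemma is_derive_smoothstep (x h t : R) : h != 0 ->
  is_derive t 1 (fun t => smoothstep ((t - x) / h)) (tent ((t - x) / h) / h).
Proof.
move=> h0; apply: (@is_derive1_quadratic _ _ _ (4 / h ^+ 2)) => k.
have -> : (t + k - x) / h = (t - x) / h + k / h by field.
rewrite -mulrA (mulrC h^-1); apply: le_trans (smoothstep_quadratic _ _) _.
by rewrite expr_div_n mulrA mulrAC.
Qed.

Lemma continuous_tent (x h : R) : continuous (fun t => tent ((t - x) / h) / h).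
Proof.
have H (c : R) : continuous (fun t : R => `|(t - x) / h - c|).
  move=> t; apply: cvg_norm; apply: cvgB; last exact: cvg_cst.
  by apply: cvgMl; apply: cvgB; [exact: cvg_id|exact: cvg_cst].
move=> t; apply: cvgMl; apply: cvgMr; apply: cvgD; last exact: H.
apply: cvgB; last by apply: cvgMr; exact: H.
have := H 0 t; rewrite /continuous_at subr0.
by under eq_fun do rewrite subr0.
Qed.

End smoothstep.

(** * Increments of a continuous function from its weak derivative *)

Section weak_derivative.
Variable R : realType.
Implicit Types (f g u : R -> R).
Local Notation mu := (@lebesgue_measure R).
Local Notation I := (`[0, 1]%classic : set R).
Let mI : measurable I. Proof. exact: measurable_itv. Qed.

Lemma within_continuousP f : {within I, continuous f} <->
  forall x, 0 <= x <= 1 -> forall e, 0 < e -> exists2 d, 0 < d &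
    forall t, 0 <= t <= 1 -> `|t - x| < d -> `|f t - f x| <= e.
Proof.
split=> [cf x x01 e e0|H].
  have Ix : I x by rewrite /= in_itv.
  have /subspace_continuousP/(_ x Ix)/cvgrPdist_le/(_ e e0) := cf.
  move=> [d /= d0 Hd].
  exists d => // t t01 td; rewrite distrC; apply: Hd => /=.
  - by rewrite distrC.
  - by rewrite in_itv.
apply/subspace_continuousP => x Ix; apply/cvgrPdist_le => e e0.
have x01 : 0 <= x <= 1 by move: Ix; rewrite /= in_itv.
have [d d0 Hd] := H x x01 e e0.
exists d => //= t td It; rewrite distrC; apply: Hd; last by rewrite distrC.
by move: It; rewrite /= in_itv.
Qed.

Lemma Rintegral_split g (x y : R) : square_integrable g -> 0 <= x -> x <= y -> y <= 1 ->
  \int[mu]_(t in `[x, y]) g t = \int[mu]_(t in `[0, y]) g t - \int[mu]_(t in `[0, x]) g t.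
Proof.
move=> sg x0 xy y1.
have ig z : 0 <= z -> mu.-integrable `[z, y] (EFin \o g).
  move=> z0; apply: integrableS (sqi_integrable sg) => //.
  by move=> t /=; rewrite !in_itv/= => /andP[zt ty]; rewrite (le_trans z0 zt) (le_trans ty y1).
rewrite -Rintegral_itv_obnd_cbnd; last first.
  apply: integrableS (ig x x0) => //.
  by move=> t /=; rewrite !in_itv/= => /andP[/ltW -> ->].
by rewrite Rintegral_itvB//; exact: ig.
Qed.

Lemma ip_indic_itv (x y : R) : 0 <= x -> x <= y -> y <= 1 ->
  ip (\1_(`[x, y]%classic : set R)) (\1_(`[x, y]%classic : set R)) = y - x.
Proof.
move=> x0 xy y1; rewrite -Rintegral_indic//.
rewrite (@eq_Rintegral _ _ _ _ _ (cst 1)); last first.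
  by move=> t; rewrite inE => xty; rewrite indicE mem_set.
rewrite Rintegral_cst// mul1r/= lebesgue_measure_itv/= lte_fin.
by case: ltgtP xy => // -> _; rewrite subrr.
Qed.

Lemma Rintegral_sqr_le g (x y : R) : square_integrable g -> 0 <= x -> x <= y -> y <= 1 ->
  (\int[mu]_(t in `[x, y]) g t) ^+ 2 <= ip g g * (y - x).
Proof.
move=> sg x0 xy y1; rewrite Rintegral_indic// -(ip_indic_itv x0 xy y1).
by apply: ip_cauchy_schwarz => //; apply: sqi_indic.
Qed.

Lemma continuous_smoothstep (x h : R) : h != 0 ->
  continuous (fun t => smoothstep ((t - x) / h)).
Proof.
move=> h0 t; apply: differentiable_continuous; apply/derivable1_diffP.
by have [] := is_derive_smoothstep x t h0.
Qed.

(** On the unit interval the step and the indicator agree outside [x, x + h] and differ by at most 1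
    inside, so Cauchy-Schwarz bounds the error by the norm of g times sqrt h. *)
Lemma ip_smoothstep g (x h : R) : square_integrable g -> 0 <= x -> 0 < h -> x + h <= 1 ->
  (ip g (fun t => smoothstep ((t - x) / h)) - ip g (\1_(`[x, 1]%classic : set R))) ^+ 2
    <= ip g g * h.
Proof.
move=> sg x0 h0 xh1.
have sS : square_integrable (fun t : R => smoothstep ((t - x) / h)).
  by apply: sqi_continuous; apply: continuous_subspaceT; apply: continuous_smoothstep; rewrite gt_eqF.
have s1 : square_integrable (\1_(`[x, 1]%classic : set R) : R -> R) by apply: sqi_indic.
have s2 : square_integrable (\1_(`[x, x + h]%classic : set R) : R -> R) by apply: sqi_indic.
have sD := sqiB sS s1.
rewrite -ipBr//; apply: le_trans (ip_cauchy_schwarz sg sD) _.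
rewrite ler_wpM2l ?ip_ge0//.
rewrite [leRHS](_ : h = (x + h) - x); last by rewrite addrC addKr.
rewrite -(@ip_indic_itv x (x + h))//; last by rewrite lerDl ltW.
rewrite /ip; apply: le_Rintegral => //; [exact: sqi_mul|exact: sqi_mul|].
move=> t /=; rewrite in_itv/= => /andP[t0 t1].
rewrite !indicE !mem_setE !in_itv/= t1 andbT.
have [xt|tx] := leP x t; last first.
  by rewrite smoothstep_le0 ?subrr ?mul0r// pmulr_lle0 ?invr_gt0// subr_le0 ltW.
have [txh|xht] := leP t (x + h); last first.
  by rewrite smoothstep_ge1 ?subrr ?mul0r// ler_pdivlMr// mul1r lerBrDl ltW.
by rewrite /= mulr1; have := smoothstep_ge0_le1 ((t - x) / h); nra.
Qed.

Lemma ip_tent1 (x h : R) : 0 <= x -> 0 < h -> x + h <= 1 ->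
  \int[mu]_(t in I) (tent ((t - x) / h) / h) = 1.
Proof.
move=> x0 h0 xh1; have hn0 : h != 0 by rewrite gt_eqF.
rewrite /Rintegral (@continuous_FTC2 _ _ (fun t => smoothstep ((t - x) / h)))//.
- have -> : smoothstep ((1 - x) / h) = 1.
    by apply: smoothstep_ge1; rewrite ler_pdivlMr// mul1r lerBrDl.
  have -> : smoothstep ((0 - x) / h) = 0.
    by apply: smoothstep_le0; rewrite sub0r mulNr oppr_le0 divr_ge0// ltW.
  by rewrite -EFinB subr0.
- by apply: continuous_subspaceT; exact: continuous_tent.
- split.
  + by move=> t _; have [] := is_derive_smoothstep x t hn0.
  + by apply: cvg_at_right_filter; exact: continuous_smoothstep.
  + by apply: cvg_at_left_filter; exact: continuous_smoothstep.
- by move=> t _; rewrite derive1E; have [_ ->] := is_derive_smoothstep x t hn0.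
Qed.

(** The scaled tents have mass 1 and support [x, x + h]: an approximate identity at x, from the
    right. *)
Lemma ip_tent u (x h e : R) : {within I, continuous u} -> 0 <= x -> 0 < h -> x + h <= 1 ->
  (forall t, x <= t <= x + h -> `|u t - u x| <= e) ->
  `|ip u (fun t => tent ((t - x) / h) / h) - u x| <= e.
Proof.
move=> cu x0 h0 xh1 ue.
have su := sqi_continuous cu.
have sk : square_integrable (fun t : R => tent ((t - x) / h) / h).
  by apply: sqi_continuous; apply: continuous_subspaceT; exact: continuous_tent.
have sc := @sqi_cst R (u x).
have -> : u x = ip (fun=> u x) (fun t => tent ((t - x) / h) / h).
  by rewrite /ip RintegralZl ?ip_tent1 ?mulr1//; exact: sqi_integrable.
rewrite -ipBl// /ip.
have ie : mu.-integrable I (EFin \o (fun t => (u t - u x) * (tent ((t - x) / h) / h))).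
  by apply: sqi_mul => //; exact: sqiB.
apply: le_trans (@le_normr_Rintegral _ _ _ mu I _ mI ie) _.
have -> : e = \int[mu]_(t in I) (e * (tent ((t - x) / h) / h)).
  by rewrite RintegralZl ?ip_tent1 ?mulr1//; exact: sqi_integrable.
apply: le_Rintegral => //.
- exact: (@integrable_norm _ _ _ mu I _ ie).
- exact: sqi_integrable (sqiZ e sk).
move=> t _; rewrite normrM.
have k0 : 0 <= tent ((t - x) / h) / h by rewrite divr_ge0 ?tent_ge0// ltW.
rewrite (ger0_norm k0); have [xt|tx] := leP x t; last first.
  by rewrite tent_le0 ?mul0r ?mulr0// pmulr_lle0 ?invr_gt0// subr_le0 ltW.
have [txh|xht] := leP t (x + h); last first.
  by rewrite tent_ge1 ?mul0r ?mulr0// ler_pdivlMr// mul1r lerBrDl ltW.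
by rewrite ler_wpM2r//; apply: ue; rewrite xt.
Qed.

End weak_derivative.

Section fundamental.
Variable R : realType.
Implicit Types (f g u : R -> R).
Local Notation mu := (@lebesgue_measure R).
Local Notation I := (`[0, 1]%classic : set R).

Lemma ler_norm_sqr (x e : R) : 0 <= e -> x ^+ 2 <= e ^+ 2 -> `|x| <= e.
Proof. by move=> e0 xe; rewrite ler_norml; nra. Qed.

(** A C^1 plateau that approximates the indicator of [x, y], while its derivative is the difference
    of two approximate identities, at x and at y. *)
Lemma C1c01_smoothstep (x y h : R) : 0 < x -> x <= y -> 0 < h -> y + h < 1 ->
  C1c01 (fun t => smoothstep ((t - x) / h) - smoothstep ((t - y) / h)) /\
  derive1 (fun t => smoothstep ((t - x) / h) - smoothstep ((t - y) / h)) =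
    (fun t => tent ((t - x) / h) / h - tent ((t - y) / h) / h).
Proof.
move=> x0 xy h0 yh1; have hn0 : h != 0 by rewrite gt_eqF.
have D (t : R) : is_derive t (1 : R)
    (fun t => smoothstep ((t - x) / h) - smoothstep ((t - y) / h))
    (tent ((t - x) / h) / h - tent ((t - y) / h) / h).
  by apply: is_deriveB; exact: is_derive_smoothstep.
have D1 : derive1 (fun t => smoothstep ((t - x) / h) - smoothstep ((t - y) / h)) =
    (fun t => tent ((t - x) / h) / h - tent ((t - y) / h) / h).
  by apply/funext => t; rewrite derive1E; have [_ ->] := D t.
split=> //; split; first by move=> t; have [] := D t.
- by rewrite D1 => t; apply: cvgB; exact: continuous_tent.
- exists x, (y + h); split=> // t; rewrite in_itv/= negb_and -!ltNge => /orP[tx|yt].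
    by rewrite !smoothstep_le0 ?subrr// pmulr_lle0 ?invr_gt0//; lra.
  by rewrite !smoothstep_ge1 ?subrr// ler_pdivlMr// mul1r; lra.
Qed.

(** Testing with the plateau of [C1c01_smoothstep] for small h turns the definition of a weak
    derivative into this formula up to an arbitrary error. *)
Lemma weak_derivative_interior u g (x y : R) :
  {within I, continuous u} -> square_integrable g -> weak_derivative u g ->
  0 < x -> x <= y -> y < 1 ->
  u y - u x = \int[mu]_(t in `[x, y]) g t.
Proof.
move=> cu sg wd x0 xy y1.
have su := sqi_continuous cu.
rewrite Rintegral_split//; [|lra|lra].
have s1 z : square_integrable (\1_(`[z, 1]%classic : set R) : R -> R) by apply: sqi_indic.
have tail z : 0 <= z -> z <= 1 -> ip g (\1_(`[z, 1]%classic : set R)) =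
    \int[mu]_(t in `[0, 1]) g t - \int[mu]_(t in `[0, z]) g t.
  by move=> z0 z1; rewrite -Rintegral_indic// Rintegral_split.
apply/eqP; rewrite -subr_eq0 -normr_le0; apply/ler_addgt0Pr => e' e'0.
(* Four errors occur: one from a tent and one from a step at each of x and y. *)
rewrite add0r; pose e := e' / 4; have e0 : 0 < e by rewrite divr_gt0.
have [dx dx0 Hx] := (within_continuousP u).1 cu x (ltac:(lra)) e e0.
have [dy dy0 Hy] := (within_continuousP u).1 cu y (ltac:(lra)) e e0.
pose K := ip g g; have K0 : 0 <= K by exact: ip_ge0.
have dX t : x <= t <= x + dx / 2 -> `|t - x| < dx.
  by move=> xt; rewrite ger0_norm; lra.
have dY t : y <= t <= y + dy / 2 -> `|t - y| < dy.
  by move=> xt; rewrite ger0_norm; lra.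
(* The bounds by dx and dy serve the tents, K * h <= e^2 serves the steps, and y + h < 1 keeps the
   support inside the open interval. *)
have [h [h0 hx hy h1 hK]] : exists h, [/\ 0 < h, h <= dx / 2, h <= dy / 2, y + h < 1 & K * h <= e ^+ 2].
  pose m := Num.min (Num.min dx dy) (Num.min (1 - y) (e ^+ 2 / (K + 1))).
  have m0 : 0 < m.
    by rewrite !lt_min dx0 dy0 subr_gt0 y1 divr_gt0 ?exprn_gt0// ltr_wpDl.
  have : m <= m by []; rewrite {2}/m !le_min => /andP[/andP[m1 m2] /andP[m3 m4]].
  exists (m / 2); split; [lra|lra|lra|lra|].
  move: m4; rewrite ler_pdivlMr ?ltr_wpDl//; clear -K0 m0; nra.
have [x0' x1' y0' xh1 yh1'] : [/\ 0 <= x, x <= 1, 0 <= y, x + h <= 1 & y + h <= 1].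
  by split; lra.
have [Cphi phi'] := C1c01_smoothstep x0 xy h0 h1.
have hn0 : h != 0 by rewrite gt_eqF.
have sS z : square_integrable (fun t : R => smoothstep ((t - z) / h)).
  by apply: sqi_continuous; apply: continuous_subspaceT; exact: continuous_smoothstep.
have sT z : square_integrable (fun t : R => tent ((t - z) / h) / h).
  by apply: sqi_continuous; apply: continuous_subspaceT; exact: continuous_tent.
have W : ip u (fun t => tent ((t - x) / h) / h) - ip u (fun t => tent ((t - y) / h) / h) =
    - (ip g (fun t => smoothstep ((t - x) / h)) - ip g (fun t => smoothstep ((t - y) / h))).
  rewrite -ipBr// -ipBr//.
  by have := wd _ Cphi; rewrite phi'.
have Ux : `|ip u (fun t => tent ((t - x) / h) / h) - u x| <= e.
  apply: ip_tent => // t /andP[xt th]; apply: Hx.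
    by rewrite (le_trans x0' xt) (le_trans th xh1).
  by apply: dX; rewrite xt (le_trans th)// lerD2l.
have Uy : `|ip u (fun t => tent ((t - y) / h) / h) - u y| <= e.
  apply: ip_tent => // t /andP[yt th]; apply: Hy.
    by rewrite (le_trans y0' yt) (le_trans th yh1').
  by apply: dY; rewrite yt (le_trans th)// lerD2l.
have G z : 0 <= z -> z + h <= 1 ->
    `|ip g (fun t => smoothstep ((t - z) / h)) - ip g (\1_(`[z, 1]%classic : set R))| <= e.
  move=> z0 zh; apply: ler_norm_sqr; first exact: ltW.
  exact: le_trans (ip_smoothstep sg z0 h0 zh) hK.
have Gx := G x x0' xh1; have Gy := G y y0' yh1'.
have y1'' := ltW y1; rewrite !tail// in Gx Gy.
have -> : e' = 4 * e by rewrite /e; field.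
move: Ux Uy Gx Gy W; rewrite !ler_norml; clear; lra.
Qed.

Lemma near_interior (z d : R) : 0 <= z <= 1 -> 0 < d ->
  exists x : R, [/\ 0 < x, x < 1 & `|x - z| < d].
Proof.
move=> z01 d0; pose m := Num.min d 1 / 4.
have [m0 md m1] : [/\ 0 < m, m < d & m < 1 / 2].
  have d1 : Num.min d 1 <= d by rewrite ge_min lexx.
  have d2 : Num.min d 1 <= 1 by rewrite ge_min lexx orbT.
  have d3 : 0 < Num.min d 1 by rewrite lt_min d0 ltr01.
  by rewrite /m; split; lra.
have [z2|z2] := leP z (1 / 2).
- by exists (z + m); split; [lra|lra|rewrite ger0_norm; lra].
- by exists (z - m); split; [lra|lra|rewrite ler0_norm; lra].
Qed.

(** Test functions vanish near 0 and 1, so the endpoints need continuity: the primitive [G] is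
    1/2-Hoelder, and u - G, constant in the interior, is constant up to the boundary. *)
Lemma weak_derivative_Rintegral u g (x y : R) :
  {within I, continuous u} -> square_integrable g -> weak_derivative u g ->
  0 <= x -> x <= y -> y <= 1 ->
  u y - u x = \int[mu]_(t in `[x, y]) g t.
Proof.
move=> cu sg wd x0 xy y1.
pose G z := \int[mu]_(t in `[0, z]) g t.
have K0 : 0 <= ip g g by exact: ip_ge0.
have Gsqr z t : 0 <= z <= 1 -> 0 <= t <= 1 -> (G t - G z) ^+ 2 <= ip g g * `|t - z|.
  wlog zt : z t / z <= t.
    move=> H z01 t01; have [zt|/ltW tz] := leP z t; first exact: H.
    by rewrite distrC -(sqrrN (G t - G z)) opprB; exact: H.
  move=> z01 t01; rewrite /G -Rintegral_split//; [|lra|lra].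
  by rewrite ger0_norm ?subr_ge0//; apply: Rintegral_sqr_le => //; lra.
have cG : {within I, continuous G}.
  apply/within_continuousP => z z01 e e0.
  exists (e ^+ 2 / (ip g g + 1)); first by rewrite divr_gt0 ?exprn_gt0// ltr_wpDl.
  move=> t t01; rewrite ltr_pdivlMr ?ltr_wpDl// => tz.
  apply: ler_norm_sqr; first exact: ltW.
  apply: le_trans (Gsqr _ _ z01 t01) _.
  by have := normr_ge0 (t - z); nra.
have c2 : 0 < (1 / 2 : R) < 1 by lra.
have H z t : 0 < z < 1 -> 0 < t < 1 -> u t - u z = G t - G z.
  wlog zt : z t / z <= t.
    move=> H z01 t01; have [zt|/ltW tz] := leP z t; first exact: H.
    by apply: oppr_inj; rewrite !opprB; exact: H.
  move=> z01 t01; rewrite (weak_derivative_interior cu sg wd)//; [|lra|lra].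
  by rewrite /G Rintegral_split//; lra.
have E z : 0 <= z <= 1 -> u z - G z = u (1 / 2) - G (1 / 2).
  move=> z01; apply/eqP; rewrite -subr_eq0 -normr_le0; apply/ler_addgt0Pr => e e0.
  have e2 : 0 < e / 2 by rewrite divr_gt0.
  have [d1 d10 H1] := (within_continuousP u).1 cu z z01 _ e2.
  have [d2 d20 H2] := (within_continuousP G).1 cG z z01 _ e2.
  have [t [t0 t1 tz]] := near_interior z01 (ltac:(by rewrite lt_min d10 d20) : 0 < Num.min d1 d2).
  move: tz; rewrite lt_min => /andP[tz1 tz2].
  have t01 : 0 <= t <= 1 by rewrite !ltW.
  have t01' : 0 < t < 1 by rewrite t0.
  have := H1 t t01 tz1; have := H2 t t01 tz2.
  by have := H (1 / 2) t c2 t01'; rewrite !ler_norml; clear; lra.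
rewrite Rintegral_split//; have := E x (ltac:(lra)); have := E y (ltac:(lra)).
by rewrite /G; lra.
Qed.

(** The embedding of H^1 into C^{1/2}, kept squared: in this root-free form it passes to limits. *)
Lemma weak_derivative_hoelder u g (x y : R) :
  {within I, continuous u} -> square_integrable g -> weak_derivative u g ->
  0 <= x <= 1 -> 0 <= y <= 1 ->
  (u y - u x) ^+ 2 <= ip g g * `|y - x|.
Proof.
move=> cu sg wd; wlog xy : x y / x <= y.
  move=> H x01 y01; have [xy|/ltW yx] := leP x y; first exact: H.
  by rewrite distrC -(sqrrN (u y - u x)) opprB; exact: H.
move=> /andP[x0 x1] /andP[y0 y1].
rewrite (weak_derivative_Rintegral cu sg wd)// ger0_norm ?subr_ge0//.
exact: Rintegral_sqr_le.
Qed.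

End fundamental.

(** * Compactness in H2 *)

Section scalar_compactness.
Variable R : realType.
Implicit Types (f g u : R -> R).
Local Notation mu := (@lebesgue_measure R).
Local Notation I := (`[0, 1]%classic : set R).
Let mI : measurable I. Proof. exact: measurable_itv. Qed.

Lemma sqr_dist_continuous (K : R) u : 0 <= K ->
  (forall x y, 0 <= x <= 1 -> 0 <= y <= 1 -> (u y - u x) ^+ 2 <= K * `|y - x|) ->
  {within I, continuous u}.
Proof.
move=> K0 H; apply/within_continuousP => z z01 e e0.
exists (e ^+ 2 / (K + 1)); first by rewrite divr_gt0 ?exprn_gt0// ltr_wpDl.
move=> t t01; rewrite ltr_pdivlMr ?ltr_wpDl// => tz.
apply: ler_norm_sqr; first exact: ltW.
apply: le_trans (H _ _ z01 t01) _.
by have := normr_ge0 (t - z); nra.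
Qed.

(** A net indexed by a finite type: what holds along a filter at each grid point holds along it at
    all of them together. *)
Lemma unit_grid (d : R) : 0 < d -> exists m : nat,
  forall x : R, 0 <= x <= 1 -> exists i : 'I_m.+2,
    0 <= (i%:R / m.+1%:R : R) <= 1 /\ `|x - i%:R / m.+1%:R| <= d.
Proof.
move=> d0; pose m := Num.truncn (d^-1).
have m0 : 0 < m.+1%:R :> R by rewrite ltr0n.
have md : m.+1%:R^-1 <= d.
  have dV0 : 0 <= d^-1 by rewrite invr_ge0 ltW.
  have /andP[_ H] := truncn_itv dV0.
  by rewrite invf_ple ?posrE ?ltW// ltW.
exists m => x /andP[x0 x1].
have xm0 : 0 <= x * m.+1%:R by rewrite mulr_ge0// ltW.
have /andP[H1 H2] := truncn_itv xm0.
(* At x = 1 the index is m + 1, hence m + 2 grid points. *)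
have im : (Num.truncn (x * m.+1%:R) < m.+2)%N.
  rewrite ltnS -(ler_nat R); apply: le_trans H1 _.
  by rewrite ler_piMl// ltW.
exists (Ordinal im) => /=; set k := Num.truncn _ in H1 H2 im *.
have kx : k%:R / m.+1%:R <= x by rewrite ler_pdivrMr.
split; first by rewrite divr_ge0 ?ler0n//= (le_trans kx x1).
rewrite ger0_norm ?subr_ge0//; apply: le_trans md.
rewrite [leRHS](_ : _ = k.+1%:R / m.+1%:R - k%:R / m.+1%:R); last first.
  by rewrite -mulrBl -natrB// subSnn mul1r.
by rewrite lerD2r ler_pdivlMr// ltW.
Qed.

(* Arzela-Ascoli along an ultrafilter: pointwise limits exist for free, and
   equicontinuity makes them uniform. *)
Lemma ultra_ascoli (U : set_system nat) (u : nat -> R -> R) (K M : R) :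
  UltraFilter U -> 0 <= K ->
  (forall n x, 0 <= x <= 1 -> `|u n x| <= M) ->
  (forall n x y, 0 <= x <= 1 -> 0 <= y <= 1 ->
    (u n y - u n x) ^+ 2 <= K * `|y - x|) ->
  exists w : R -> R,
    (forall x y, 0 <= x <= 1 -> 0 <= y <= 1 -> (w y - w x) ^+ 2 <= K * `|y - x|) /\
    forall e, 0 < e -> U [set n | forall x, 0 <= x <= 1 -> `|u n x - w x| <= e].
Proof.
move=> UU K0 uM uK.
have /choice[w uw] : forall x, exists l : R, 0 <= x <= 1 -> (fun n => u n x) @ U --> l.
  move=> x; have [x01|x01] := boolP (0 <= x <= 1); last by exists 0.
  have [l ul] := ultra_bounded_cvg UU (fun n => uM n x x01).
  by exists l.
have wK x y : 0 <= x <= 1 -> 0 <= y <= 1 -> (w y - w x) ^+ 2 <= K * `|y - x|.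
  move=> x01 y01.
  have H : (fun n => (u n y - u n x) ^+ 2) @ U --> (w y - w x) ^+ 2.
    by under eq_fun do rewrite expr2; apply: cvgM; apply: cvgB; exact: uw.
  by apply: (cvgr_to_le H); apply: nearW => n; exact: uK.
exists w; split=> // e e0.
have e3 : 0 < e / 3 by rewrite divr_gt0.
have d0 : 0 < (e / 3) ^+ 2 / (K + 1) by rewrite divr_gt0 ?exprn_gt0// ltr_wpDl.
have [m Hm] := unit_grid d0.
have grid : \forall n \near U, forall i : 'I_m.+2,
    0 <= (i%:R / m.+1%:R : R) <= 1 -> `|u n (i%:R / m.+1%:R) - w (i%:R / m.+1%:R)| <= e / 3.
  apply: filter_forall => i.
  have [i01|_] := boolP (0 <= (i%:R / m.+1%:R : R) <= 1); last exact: nearW.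
  have /cvgrPdist_le/(_ _ e3) := uw _ i01.
  by apply: filterS => n H _; rewrite distrC.
apply: filterS grid => n Hn x x01 /=.
have [i [i01 xi]] := Hm x x01.
set z := i%:R / m.+1%:R in i01 xi.
have small v : (v x - v z) ^+ 2 <= K * `|x - z| -> `|v x - v z| <= e / 3.
  move=> H; apply: ler_norm_sqr; first exact: ltW.
  apply: le_trans H _; move: xi; rewrite ler_pdivlMr ?ltr_wpDl//.
  by have := normr_ge0 (x - z); nra.
have := small _ (uK n _ _ i01 x01); have := small _ (wK _ _ i01 x01).
have := Hn i i01; rewrite -/z !ler_norml; clear; lra.
Qed.

(** The condition [A k] changes with the index, so that a rate of convergence can be imposed along
    the subsequence. *)
Lemma subsequence_in (A : nat -> set nat) :
  (forall k m, exists2 n, (m < n)%N & A k n) ->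
  exists s : nat -> nat, {homo s : m n / (m < n)%N} /\ forall k, A k (s k).
Proof.
move=> H.
have /choice[F HF] : forall p : nat * nat, exists n, (p.2 < n)%N /\ A p.1 n.
  by move=> [k m]; have [n] := H k m; exists n.
pose s := fix s n := if n is m.+1 then F (m.+1, s m) else F (0%N, 0%N).
have sS n : (s n < s n.+1)%N by have [] := HF (n.+1, s n).
exists s; split.
- by apply: homo_ltn => [|//]; exact: ltn_trans.
- by case=> [|k]; [have [] := HF (0%N, 0%N)|have [] := HF (k.+1, s k)].
Qed.

Definition ucvg (u : nat -> R -> R) (w : R -> R) :=
  forall e, 0 < e -> exists N, forall n, (N <= n)%N ->
    forall x, 0 <= x <= 1 -> `|u n x - w x| <= e.

Lemma ucvg_cvg (u : nat -> R -> R) (w : R -> R) x : ucvg u w -> 0 <= x <= 1 ->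
  (fun n => u n x) @ \oo --> w x.
Proof.
move=> uw x01; apply/cvgrPdist_le => e e0; have [N HN] := uw e e0.
by exists N => // n Nn; rewrite distrC; exact: HN.
Qed.

Lemma ip_le_sqr f (d : R) : square_integrable f ->
  (forall x, 0 <= x <= 1 -> `|f x| <= d) -> ip f f <= d ^+ 2.
Proof.
move=> sf fd.
have -> : d ^+ 2 = \int[mu]_(x in I) (d ^+ 2).
  by rewrite Rintegral_cst//= (lebesgue_I R) mulr1.
rewrite /ip; apply: le_Rintegral => //; [exact: sqi_mul| |].
  exact: sqi_integrable (@sqi_cst R _).
move=> x /=; rewrite in_itv/= => x01.
have := fd x x01; have := normr_ge0 (f x); rewrite -expr2 -(real_normK (num_real (f x))).
by nra.
Qed.

Lemma ucvg_ip (u : nat -> R -> R) (w h : R -> R) :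
  (forall n, {within I, continuous (u n)}) -> {within I, continuous w} ->
  ucvg u w -> square_integrable h -> (fun n => ip (u n) h) @ \oo --> ip w h.
Proof.
move=> cu cw uw sh; apply/cvgrPdist_le => e e0.
have h0 := ip_ge0 h.
pose d := e / (ip h h + 1).
have d0 : 0 < d by rewrite divr_gt0// ltr_wpDl.
have [N HN] := uw d d0; exists N => // n Nn.
have su := sqi_continuous (cu n); have sw := sqi_continuous cw.
have sb := sqiB su sw; rewrite distrC -ipBl//.
have dd : ip (fun x => u n x - w x) (fun x => u n x - w x) <= d ^+ 2.
  by apply: ip_le_sqr => //; exact: HN.
apply: ler_norm_sqr; first exact: ltW.
apply: le_trans (ip_cauchy_schwarz sb sh) _.
apply: le_trans (_ : d ^+ 2 * ip h h <= _); first by rewrite ler_wpM2r.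
have -> : e = d * (ip h h + 1) by rewrite /d divfK// gt_eqF// ltr_wpDl.
by have := ltW d0; nra.
Qed.

Lemma sqi_C1c01 (phi : R -> R) : C1c01 phi ->
  square_integrable phi /\ square_integrable (derive1 phi).
Proof.
move=> [dphi cphi _]; split; apply: sqi_continuous; apply: continuous_subspaceT => //.
by move=> x; apply: differentiable_continuous; apply/derivable1_diffP; exact: dphi.
Qed.

(** Test functions and their derivatives are square-integrable, so both sides of the defining
    identity pass to weak limits. *)
Lemma weak_derivative_cvg (u g : nat -> R -> R) (u' g' : R -> R) :
  (forall h, square_integrable h -> (fun n => ip (u n) h) @ \oo --> ip u' h) ->
  (forall h, square_integrable h -> (fun n => ip (g n) h) @ \oo --> ip g' h) ->
  (forall n, weak_derivative (u n) (g n)) -> weak_derivative u' g'.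
Proof.
move=> uu gg wd phi Cphi; have [s1 s2] := sqi_C1c01 Cphi.
have H1 := uu _ s2.
have H2 : - (fun n => ip (g n) phi) @ \oo --> - ip g' phi by apply: cvgN; exact: gg.
have E : (fun n => ip (u n) (derive1 phi)) = - (fun n => ip (g n) phi).
  by apply/funext => n; exact: wd n phi Cphi.
by rewrite E in H1; exact: (cvg_unique (@Rhausdorff R) H1 H2).
Qed.

End scalar_compactness.

(** * Convergence in C^{1,alpha} *)

Section strong.
Variable R : realType.
Implicit Types (u v : 'rV[R]_2).

Lemma sum2 (F : 'I_2 -> R) : \sum_(j < 2) F j = F 0 + F 1.
Proof. by rewrite big_ord_recl big_ord1; congr (_ + F _); exact/val_inj. Qed.

Lemma dotE u v : dot u v = u 0 0 * v 0 0 + u 0 1 * v 0 1.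
Proof. by rewrite /dot sum2. Qed.

Lemma dot_ge0 u : 0 <= dot u u.
Proof. by rewrite dotE -!expr2 addr_ge0 ?sqr_ge0. Qed.

Lemma enorm_ge0 u : 0 <= enorm u. Proof. exact: sqrtr_ge0. Qed.

Lemma enorm_sqr u : enorm u ^+ 2 = dot u u.
Proof. by rewrite /enorm sqr_sqrtr ?dot_ge0. Qed.

Lemma enorm_le u (e : R) : (forall j, `|u 0 j| <= e) -> enorm u <= 2 * e.
Proof.
move=> ue; have e0 : 0 <= e by exact: le_trans (ue 0).
rewrite -(@ger0_norm _ (enorm u)) ?enorm_ge0//; apply: ler_norm_sqr; first by rewrite mulr_ge0.
rewrite enorm_sqr dotE; have := ue 0; have := ue 1; rewrite !ler_norml => /andP[a b] /andP[c d].
by nra.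
Qed.

Lemma enorm_coord u j : `|u 0 j| <= enorm u.
Proof.
apply: ler_norm_sqr; rewrite ?enorm_ge0// enorm_sqr /dot (bigD1 j)//= -expr2 lerDl.
by apply: sumr_ge0 => i _; rewrite -expr2 sqr_ge0.
Qed.

(** For r >= delta the uniform bound e = eta delta^a suffices. For r < delta the 1/2-Hoelder bound k
    r^(1/2) = k r^(1/2 - a) r^a does, as delta is chosen with k delta^(1/2 - a) = eta. Taking K + 1
    under the root keeps k positive. *)
Lemma hoelder_interpolation (K a eta : R) : 0 <= K -> 0 < a < 1 / 2 -> 0 < eta ->
  exists2 e, 0 < e & forall r d : R, 0 < r -> `|d| <= e -> d ^+ 2 <= K * r ->
    `|d| <= eta * r `^ a.
Proof.
move=> K0 /andP[a0 a12] eta0.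
pose b := 1 / 2 - a; have b0 : 0 < b by rewrite subr_gt0.
pose k := Num.sqrt (K + 1).
have k0 : 0 < k by rewrite sqrtr_gt0 ltr_wpDl.
pose delta := (eta / k) `^ (b^-1).
have delta0 : 0 < delta by rewrite powR_gt0// divr_gt0.
have deltab : delta `^ b = eta / k.
  by rewrite -powRrM mulVf ?gt_eqF// powRr1// divr_ge0// ltW.
exists (eta * delta `^ a); first by rewrite mulr_gt0// powR_gt0.
move=> r d r0 de dr; have [rd|dr'] := leP delta r.
  apply: le_trans de _; rewrite ler_wpM2l ?(ltW eta0)//.
  by apply: ge0_ler_powR; rewrite ?nnegrE ?(ltW a0) ?(ltW delta0) ?(ltW r0).
have dk : `|d| <= k * r `^ (1 / 2).
  apply: ler_norm_sqr; first by rewrite mulr_ge0 ?powR_ge0 ?ltW.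
  rewrite div1r powR12_sqrt ?(ltW r0)// exprMn !sqr_sqrtr ?(ltW r0) ?addr_ge0//.
  by apply: le_trans dr _; rewrite ler_wpM2r ?(ltW r0)// lerDl.
apply: le_trans dk _.
have -> : 1 / 2 = b + a by rewrite /b subrK.
rewrite powRD; last by rewrite (gt_eqF r0) implybT.
rewrite mulrA ler_wpM2r ?powR_ge0// mulrC -ler_pdivlMr// -deltab.
by apply: ge0_ler_powR; rewrite ?nnegrE ?(ltW b0) ?(ltW delta0) ?(ltW r0) ?(ltW dr').
Qed.

Lemma C1alpha_norm_ge0 (a : R) (u du : R -> 'rV[R]_2) : (0 <= C1alpha_norm a u du)%E.
Proof.
have z01 : `[0%R, 1%R]%classic (0 : R) by rewrite /= in_itv/= lexx ler01.
rewrite /C1alpha_norm !adde_ge0//; apply: ereal_sup_ge.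
- by exists (enorm (u 0))%:E; [exists 0|rewrite lee_fin enorm_ge0].
- by exists (enorm (du 0))%:E; [exists 0|rewrite lee_fin enorm_ge0].
- exists (enorm (du 0 - du 1) / `|0 - 1| `^ a)%:E.
    by exists (0, 1) => //=; split; rewrite ?lexx ?ler01// eq_sym oner_neq0.
  by rewrite lee_fin divr_ge0 ?enorm_ge0 ?powR_ge0.
Qed.

Lemma C1alpha_norm_le (a e eta : R) (u du : R -> 'rV[R]_2) :
  (forall x j, 0 <= x <= 1 -> `|u x 0 j| <= e) ->
  (forall x j, 0 <= x <= 1 -> `|du x 0 j| <= e) ->
  (forall x y j, 0 <= x <= 1 -> 0 <= y <= 1 -> x != y ->
     `|du x 0 j - du y 0 j| <= eta * `|x - y| `^ a) ->
  (C1alpha_norm a u du <= (2 * e + 2 * e + 2 * eta)%:E)%E.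
Proof.
move=> ue due dueta; rewrite /C1alpha_norm !EFinD; apply: leeD; first apply: leeD.
- apply: ge_ereal_sup => _ [x x01 <-]; rewrite lee_fin; apply: enorm_le => j.
  by apply: ue; move: x01; rewrite /= in_itv.
- apply: ge_ereal_sup => _ [x x01 <-]; rewrite lee_fin; apply: enorm_le => j.
  by apply: due; move: x01; rewrite /= in_itv.
- apply: ge_ereal_sup => _ [[x y] /= [x01 y01 xy] <-]; rewrite lee_fin.
  have r0 : 0 < `|x - y| `^ a by rewrite powR_gt0// normr_gt0 subr_eq0.
  rewrite ler_pdivrMr// -mulrA; apply: enorm_le => j.
  by rewrite !mxE; exact: dueta.
Qed.

Lemma cvg_ereal0 (f : nat -> \bar R) : (forall n, (0 <= f n)%E) ->
  (forall e : R, 0 < e -> exists N, forall n, (N <= n)%N -> (f n <= e%:E)%E) ->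
  f @ \oo --> 0%E.
Proof.
move=> f0 fe; have fin n e : (f n <= e%:E)%E -> f n \is a fin_num.
  by move=> H; rewrite ge0_fin_numE//; exact: le_lt_trans H (ltry _).
apply/fine_cvgP; split.
  by have [N HN] := fe 1 ltr01; exists N => // n Nn; exact: fin (HN n Nn).
apply/cvgrPdist_le => e e0; have [N HN] := fe e e0; exists N => // n Nn /=.
rewrite sub0r normrN ger0_norm ?fine_ge0//.
by rewrite -lee_fin fineK; [exact: HN|exact: fin (HN n Nn)].
Qed.

Lemma strong_C1alpha_cvg_ucvg (K a : R) (c : nat -> H2curve R) (d : H2curve R) :
  0 <= K -> 0 < a < 1 / 2 ->
  (forall n j x y, 0 <= x <= 1 -> 0 <= y <= 1 ->
    (vel (c n) y 0 j - vel (c n) x 0 j) ^+ 2 <= K * `|y - x|) ->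
  (forall j x y, 0 <= x <= 1 -> 0 <= y <= 1 ->
    (vel d y 0 j - vel d x 0 j) ^+ 2 <= K * `|y - x|) ->
  (forall j, ucvg (fun n x => pos (c n) x 0 j) (fun x => pos d x 0 j)) ->
  (forall j, ucvg (fun n x => vel (c n) x 0 j) (fun x => vel d x 0 j)) ->
  strong_C1alpha_cvg a c d.
Proof.
move=> K0 a12 cK dK cp cv; apply: cvg_ereal0 => [n|eta eta0].
  exact: C1alpha_norm_ge0.
(* The difference of two functions whose squared increments are at most K r has squared increments
   at most 4 K r. *)
have K4 : 0 <= 4 * K by rewrite mulr_ge0.
have eta4 : 0 < eta / 4 by rewrite divr_gt0.
have eta8 : 0 < eta / 8 by rewrite divr_gt0.
have [e e0 He] := hoelder_interpolation K4 a12 eta4.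
(* e / 2 at each of two points makes an increment of at most e, and eta / 8 makes the three parts of
   the norm sum to at most eta. *)
pose e' := Num.min (e / 2) (eta / 8).
have e'0 : 0 < e' by rewrite lt_min divr_gt0.
have [e'1 e'2] : e' <= e / 2 /\ e' <= eta / 8 by rewrite /e' !ge_min !lexx orbT.
have unif (u : 'I_2 -> nat -> R -> R) (w : 'I_2 -> R -> R) :
    (forall j, ucvg (u j) (w j)) -> exists N, forall n, (N <= n)%N ->
    forall j x, 0 <= x <= 1 -> `|u j n x - w j x| <= e'.
  move=> uw; have [N0 H0] := uw 0 e' e'0; have [N1 H1] := uw 1 e' e'0.
  exists (maxn N0 N1) => n; rewrite geq_max => /andP[n0 n1] j x x01.
  case: j => [[|[|//]] Hj].
  - by rewrite (_ : Ordinal Hj = 0) ?H0//; exact/val_inj.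
  - by rewrite (_ : Ordinal Hj = 1) ?H1//; exact/val_inj.
have [Np Hp] := unif (fun j n x => pos (c n) x 0 j) (fun j x => pos d x 0 j) cp.
have [Nv Hv] := unif (fun j n x => vel (c n) x 0 j) (fun j x => vel d x 0 j) cv.
exists (maxn Np Nv) => n; rewrite geq_max => /andP[np nv].
apply: le_trans (_ : (2 * e' + 2 * e' + 2 * (eta / 4))%:E <= _)%E; last first.
  by rewrite lee_fin; lra.
apply: C1alpha_norm_le => [x j x01|x j x01|x y j x01 y01 xy].
- by rewrite !mxE; exact: Hp.
- by rewrite !mxE; exact: Hv.
rewrite !mxE; apply: He.
- by rewrite normr_gt0 subr_eq0.
- have := Hv n nv j x x01; have := Hv n nv j y y01.
  by rewrite !ler_norml => /andP[h1 h2] /andP[h3 h4]; apply/andP; split; lra.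
- have := cK n j y x y01 x01; have := dK j y x y01 x01.
  set A := vel (c n) x 0 j; set B := vel (c n) y 0 j.
  set C := vel d x 0 j; set D := vel d y 0 j.
  by have := sqr_ge0 ((A - B) + (C - D)); nra.
Qed.

End strong.

(** * Bounded sequences of curves *)

Section compactness.
Variable R : realType.
Local Notation mu := (@lebesgue_measure R).
Local Notation I := (`[0, 1]%classic : set R).
Let mI : measurable I. Proof. exact: measurable_itv. Qed.

Lemma H2_innerE (c d : H2curve R) : H2_inner c d = \sum_(j < 2)
  (ip (fun x => pos c x 0 j) (fun x => pos d x 0 j) +
   ip (fun x => vel c x 0 j) (fun x => vel d x 0 j) +
   ip (fun x => acc c x 0 j) (fun x => acc d x 0 j)).
Proof.
have sp (e : H2curve R) j := sqi_continuous (@pos_continuous R e j).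
have sv (e : H2curve R) j := sqi_continuous (@vel_continuous R e j).
have sa (e : H2curve R) j := acc_square_integrable e j.
pose F j x := pos c x 0 j * pos d x 0 j + vel c x 0 j * vel d x 0 j +
  acc c x 0 j * acc d x 0 j.
have iF1 j : mu.-integrable I (EFin \o (fun x => pos c x 0 j * pos d x 0 j +
    vel c x 0 j * vel d x 0 j)).
  exact: (@integrableD _ _ _ mu I mI _ _ (sqi_mul (sp c j) (sp d j))
    (sqi_mul (sv c j) (sv d j))).
have iF j : mu.-integrable I (EFin \o F j).
  exact: (@integrableD _ _ _ mu I mI _ _ (iF1 j) (sqi_mul (sa c j) (sa d j))).
have -> : H2_inner c d = \int[mu]_(x in I) (F 0 x + F 1 x).
  by apply: eq_Rintegral => x _; rewrite !dotE /F; ring.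
rewrite RintegralD// sum2 /F; congr (_ + _).
- rewrite RintegralD//; last exact: sqi_mul.
  by rewrite RintegralD//; exact: sqi_mul.
- rewrite RintegralD//; last exact: sqi_mul.
  by rewrite RintegralD//; exact: sqi_mul.
Qed.

Lemma H2curve_of_components (p v a : 'I_2 -> R -> R) :
  (forall j, {within I, continuous (p j)}) ->
  (forall j, {within I, continuous (v j)}) ->
  (forall j, square_integrable (a j)) ->
  (forall j, weak_derivative (p j) (v j)) ->
  (forall j, weak_derivative (v j) (a j)) ->
  exists d : H2curve R, forall j,
    [/\ (fun x => pos d x 0 j) = p j, (fun x => vel d x 0 j) = v j &
        (fun x => acc d x 0 j) = a j].
Proof.
move=> cp cv sa pv va.
have E (f : 'I_2 -> R -> R) j : (fun x => (\row_k f k x) 0 j) = f j.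
  by apply/funext => x; rewrite mxE.
unshelve eexists (@MkH2curve R (fun x => \row_k p k x) (fun x => \row_k v k x)
  (fun x => \row_k a k x) _ _ _ _ _); try (by move=> j; rewrite !E).
Qed.

Definition velocity_bounded (M : R) (c : H2curve R) :=
  forall j x, 0 <= x <= 1 -> `|vel c x 0 j| <= M.

Lemma pos_hoelder (M : R) (c : H2curve R) j x y : velocity_bounded M c ->
  0 <= x <= 1 -> 0 <= y <= 1 ->
  (pos c y 0 j - pos c x 0 j) ^+ 2 <= M ^+ 2 * `|y - x|.
Proof.
move=> cM x01 y01.
have sv := sqi_continuous (@vel_continuous R c j).
apply: le_trans (weak_derivative_hoelder (@pos_continuous R c j) sv (pos_vel c j) x01 y01) _.
by rewrite ler_wpM2r//; apply: ip_le_sqr => // z; exact: cM.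
Qed.

Lemma vel_hoelder (K : R) (c : H2curve R) j x y :
  ip (fun x => acc c x 0 j) (fun x => acc c x 0 j) <= K ->
  0 <= x <= 1 -> 0 <= y <= 1 ->
  (vel c y 0 j - vel c x 0 j) ^+ 2 <= K * `|y - x|.
Proof.
move=> cK x01 y01.
apply: le_trans (weak_derivative_hoelder (@vel_continuous R c j)
  (acc_square_integrable c j) (vel_acc c j) x01 y01) _.
by rewrite ler_wpM2r.
Qed.

Lemma acc_weak_limit (c : nat -> H2curve R) (v : R -> R) (K : R) (j : 'I_2) :
  (forall n, ip (fun x => acc (c n) x 0 j) (fun x => acc (c n) x 0 j) <= K) ->
  ucvg (fun n x => vel (c n) x 0 j) v ->
  exists2 a, square_integrable a & forall g, square_integrable g ->
    (fun n => ip (fun x => acc (c n) x 0 j) g) @ \oo --> ip a g.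
Proof.
move=> cK cv.
apply: (@weak_L2_compactness R _ K (fun x => v x - v 0)) => // [n|x x01].
  exact: acc_square_integrable.
have z01 : 0 <= (0 : R) <= 1 by rewrite lexx ler01.
have -> : (fun n => \int[mu]_(t in `[0, x]) acc (c n) t 0 j) =
    (fun n => vel (c n) x 0 j - vel (c n) 0 0 j).
  apply/funext => n; have /andP[x0 x1] := x01.
  by rewrite (weak_derivative_Rintegral (@vel_continuous R (c n) j)
    (acc_square_integrable (c n) j) (vel_acc (c n) j)).
by apply: cvgB; apply: (ucvg_cvg cv).
Qed.

(** The index type [T] gives one subsequence common to all curves of a network. Uniform convergence
    is part of the conclusion because the geometry of the limit is read off pointwise. *)
Theorem H2_compactness (T : finType) (c : nat -> T -> H2curve R) (K M : R) :
  0 <= K ->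
  (forall n i j, ip (fun x => acc (c n i) x 0 j) (fun x => acc (c n i) x 0 j) <= K) ->
  (forall n i, velocity_bounded M (c n i)) ->
  (forall n i j x, 0 <= x <= 1 -> `|pos (c n i) x 0 j| <= M) ->
  exists (s : nat -> nat) (d : T -> H2curve R), {homo s : m n / (m < n)%N} /\
    forall i, [/\
      forall j, ucvg (fun n x => pos (c (s n) i) x 0 j) (fun x => pos (d i) x 0 j),
      forall j, ucvg (fun n x => vel (c (s n) i) x 0 j) (fun x => vel (d i) x 0 j),
      weak_H2_cvg (fun n => c (s n) i) (d i) &
      forall a, 0 < a < 1 / 2 -> strong_C1alpha_cvg a (fun n => c (s n) i) (d i)].
Proof.
move=> K0 cK cM cP.
have [U [UU Uoo]] := ultraFilterLemma (eventually_filter : ProperFilter \oo).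
have /choice[p Hp] : forall ij : T * 'I_2, exists w : R -> R,
    (forall x y, 0 <= x <= 1 -> 0 <= y <= 1 -> (w y - w x) ^+ 2 <= M ^+ 2 * `|y - x|) /\
    forall e, 0 < e ->
      U [set n | forall x, 0 <= x <= 1 -> `|pos (c n ij.1) x 0 ij.2 - w x| <= e].
  move=> [i j]; apply: (@ultra_ascoli _ _ (fun n x => pos (c n i) x 0 j) _ M).
  - by rewrite sqr_ge0.
  - by move=> n x; exact: cP.
  - by move=> n x y x01 y01; exact: pos_hoelder.
have /choice[v Hv] : forall ij : T * 'I_2, exists w : R -> R,
    (forall x y, 0 <= x <= 1 -> 0 <= y <= 1 -> (w y - w x) ^+ 2 <= K * `|y - x|) /\
    forall e, 0 < e ->
      U [set n | forall x, 0 <= x <= 1 -> `|vel (c n ij.1) x 0 ij.2 - w x| <= e].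
  move=> [i j]; apply: (@ultra_ascoli _ _ (fun n x => vel (c n i) x 0 j) _ M) => //.
  - by move=> n x; exact: cM.
  - by move=> n x y x01 y01; exact: vel_hoelder.
(* Every [A k] belongs to U; the explicit rate 1 / (k + 1) turns closeness along U into uniform
   convergence of the subsequence. *)
pose A k := [set n | forall ij : T * 'I_2, forall x, 0 <= x <= 1 ->
  `|pos (c n ij.1) x 0 ij.2 - p ij x| <= k.+1%:R^-1 /\
  `|vel (c n ij.1) x 0 ij.2 - v ij x| <= k.+1%:R^-1].
have [s [smono sA]] : exists s : nat -> nat, {homo s : m n / (m < n)%N} /\
    forall k, A k (s k).
  apply: subsequence_in => k m.
  have k0 : 0 < k.+1%:R^-1 :> R by rewrite invr_gt0 ltr0n.
  have H1 : \forall n \near U, forall ij : T * 'I_2, forall x, 0 <= x <= 1 ->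
      `|pos (c n ij.1) x 0 ij.2 - p ij x| <= k.+1%:R^-1.
    by apply: filter_forall => ij; exact: (Hp ij).2.
  have H2 : \forall n \near U, forall ij : T * 'I_2, forall x, 0 <= x <= 1 ->
      `|vel (c n ij.1) x 0 ij.2 - v ij x| <= k.+1%:R^-1.
    by apply: filter_forall => ij; exact: (Hv ij).2.
  (* U refines [\oo], so an index beyond m is available and the subsequence is strictly
     increasing. *)
  have H3 : \forall n \near U, (m < n)%N by apply: Uoo; exact: nbhs_infty_gt.
  have FU : Filter U by typeclasses eauto.
  have /(@filter_ex _ U)[n [[h1 h2] h3]] :=
    @filterI _ U FU _ _ (@filterI _ U FU _ _ H1 H2) H3.
  by exists n => // ij x x01; split; [exact: h1|exact: h2].
have tail (e : R) : 0 < e -> exists N, forall n, (N <= n)%N -> n.+1%:R^-1 <= e.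
  move=> e0; exists (Num.truncn e^-1) => n Nn.
  rewrite invf_ple ?posrE ?ltr0n//; have e0' : 0 <= e^-1 by rewrite invr_ge0 ltW.
  have /andP[_ /ltW H] := truncn_itv e0'; apply: le_trans H _.
  by rewrite ler_nat.
have up i j : ucvg (fun n x => pos (c (s n) i) x 0 j) (p (i, j)).
  move=> e /tail[N HN]; exists N => n /HN ne x x01.
  by apply: le_trans ne; exact: (sA n (i, j) x x01).1.
have uv i j : ucvg (fun n x => vel (c (s n) i) x 0 j) (v (i, j)).
  move=> e /tail[N HN]; exists N => n /HN ne x x01.
  by apply: le_trans ne; exact: (sA n (i, j) x x01).2.
have cp ij : {within I, continuous (p ij)}.
  by apply: (sqr_dist_continuous (sqr_ge0 M)); exact: (Hp ij).1.
have cv ij : {within I, continuous (v ij)}.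
  by apply: (sqr_dist_continuous K0); exact: (Hv ij).1.
have wp i j h : square_integrable h ->
    (fun n => ip (fun x => pos (c (s n) i) x 0 j) h) @ \oo --> ip (p (i, j)) h.
  by move=> sh; apply: ucvg_ip => // n; exact: (@pos_continuous R).
have wv i j h : square_integrable h ->
    (fun n => ip (fun x => vel (c (s n) i) x 0 j) h) @ \oo --> ip (v (i, j)) h.
  by move=> sh; apply: ucvg_ip => // n; exact: (@vel_continuous R).
have /choice[a Ha] : forall ij : T * 'I_2, exists a, square_integrable a /\
    forall g, square_integrable g ->
    (fun n => ip (fun x => acc (c (s n) ij.1) x 0 ij.2) g) @ \oo --> ip a g.
  move=> [i j]; have [a sa aw] := @acc_weak_limit (fun n => c (s n) i) _ K j
    (fun n => cK (s n) i j) (uv i j).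
  by exists a.
have /choice[d Hd] : forall i, exists d : H2curve R, forall j,
    [/\ (fun x => pos d x 0 j) = p (i, j), (fun x => vel d x 0 j) = v (i, j) &
        (fun x => acc d x 0 j) = a (i, j)].
  move=> i; apply: H2curve_of_components => j //; first exact: (Ha (i, j)).1.
  - apply: (weak_derivative_cvg (wp i j) (wv i j)) => n; exact: pos_vel.
  - apply: (weak_derivative_cvg (wv i j) (Ha (i, j)).2) => n; exact: vel_acc.
exists s, d; split=> // i.
have dp j : (fun x => pos (d i) x 0 j) = p (i, j) by have [] := Hd i j.
have dv j : (fun x => vel (d i) x 0 j) = v (i, j) by have [] := Hd i j.
have da j : (fun x => acc (d i) x 0 j) = a (i, j) by have [] := Hd i j.
have up' j : ucvg (fun n x => pos (c (s n) i) x 0 j) (fun x => pos (d i) x 0 j).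
  by rewrite dp.
have uv' j : ucvg (fun n x => vel (c (s n) i) x 0 j) (fun x => vel (d i) x 0 j).
  by rewrite dv.
split=> //.
- move=> e; rewrite H2_innerE sum2.
  have se j := sqi_continuous (@pos_continuous R e j).
  have sf j := sqi_continuous (@vel_continuous R e j).
  have sg j := acc_square_integrable e j.
  have H j : (fun n => ip (fun x => pos (c (s n) i) x 0 j) (fun x => pos e x 0 j) +
      ip (fun x => vel (c (s n) i) x 0 j) (fun x => vel e x 0 j) +
      ip (fun x => acc (c (s n) i) x 0 j) (fun x => acc e x 0 j)) @ \oo -->
      ip (fun x => pos (d i) x 0 j) (fun x => pos e x 0 j) +
      ip (fun x => vel (d i) x 0 j) (fun x => vel e x 0 j) +
      ip (fun x => acc (d i) x 0 j) (fun x => acc e x 0 j).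
    rewrite dp dv da; apply: cvgD; first apply: cvgD.
    + exact: wp.
    + exact: wv.
    + exact: (Ha (i, j)).2.
  under eq_fun do rewrite H2_innerE sum2.
  by apply: cvgD; exact: H.
- move=> al al12; apply: (@strong_C1alpha_cvg_ucvg _ K) => // [n j x y x01 y01|j x y x01 y01].
    exact: vel_hoelder.
  have /(congr1 (fun f => f x)) := dv j; have /(congr1 (fun f => f y)) := dv j.
  by move=> /= -> ->; exact: (Hv (i, j)).1.
Qed.

End compactness.

(** * Plane geometry *)

Section plane.
Variable R : realType.
Implicit Types (a b c d : 'rV[R]_2).

(** With C = cos (pi/3), the triple-angle formula and cos pi = -1 give (C + 1) (2 C - 1)^2 = 0;
    since C > 0, C = 1/2, and the angle is doubled. *)
Lemma cos_2pi3 : cos (2 * pi / 3) = - (1 / 2) :> R.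
Proof.
pose x : R := pi / 3; pose C := cos x; pose S := sin x.
have CS : C ^+ 2 + S ^+ 2 = 1 by exact: cos2Dsin2.
have C0 : 0 < C.
  apply: cos_gt0_pihalf; have := pi_gt0 R; rewrite /x => p0.
  by apply/andP; split; lra.
have E3 : - 1 = C * (C * C - S * S) - S * (S * C + C * S).
  by rewrite -!(cosD, sinD) -cospi; congr cos; rewrite /x; field.
have -> : 2 * pi / 3 = x + x by rewrite /x; field.
rewrite cosD -/C -/S.
have : (C + 1) * (2 * C - 1) ^+ 2 = 0.
  have S2 : S ^+ 2 = 1 - C ^+ 2 by rewrite -CS; ring.
  have -> : (C + 1) * (2 * C - 1) ^+ 2 = 4 * C ^+ 3 - 3 * C + 1 by ring.
  have : - 1 = C ^+ 3 - 3 * C * S ^+ 2 by rewrite [LHS]E3; ring.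
  by rewrite S2 => H; rewrite -[1]opprK [X in _ - X]H; ring.
move/eqP; rewrite mulf_eq0 sqrf_eq0 => /orP[/eqP C1|/eqP C2]; first lra.
by nra.
Qed.

Lemma dot_sqr_le a b : dot a b ^+ 2 <= dot a a * dot b b.
Proof.
rewrite !dotE; have := sqr_ge0 (a 0 0 * b 0 1 - a 0 1 * b 0 0); nra.
Qed.

Lemma angle_2pi3 a b : dot a a = 1 -> dot b b = 1 ->
  angle a b = 2 * pi / 3 <-> dot a b = - (1 / 2).
Proof.
move=> a1 b1; have := dot_sqr_le a b; rewrite a1 b1 mulr1 => ab.
have ab1 : -1 <= dot a b <= 1 by apply/andP; split; nra.
rewrite /angle /enorm a1 b1 sqrtr1 mulr1 divr1; split=> [H|->].
  by rewrite -cos_2pi3 -H acosK.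
rewrite -cos_2pi3 cosK// in_itv/=; have := pi_gt0 R => p0.
by apply/andP; split; lra.
Qed.

Lemma row2P a b : a 0 0 = b 0 0 -> a 0 1 = b 0 1 -> a = b.
Proof.
move=> e0 e1; apply/rowP => j; case: j => [[|[|//]] Hj].
- by rewrite (_ : Ordinal Hj = 0)//; exact/val_inj.
- by rewrite (_ : Ordinal Hj = 1)//; exact/val_inj.
Qed.

(** The sum w = a + b is a unit vector, and all four vectors have product 1/2 with it. Only two unit
    vectors of the plane do, mirror images across w. *)
Lemma eq_pairs_of_sum a b c d :
  dot a a = 1 -> dot b b = 1 -> dot c c = 1 -> dot d d = 1 ->
  dot a b = - (1 / 2) -> (forall j, a 0 j + b 0 j = c 0 j + d 0 j) ->
  [set a; b] = [set c; d].
Proof.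
move=> a1 b1 c1 d1 ab sum; have s0 := sum 0; have s1 := sum 1.
suff [[ac bd]|[ad bc]] : (a = c /\ b = d) \/ (a = d /\ b = c).
- by rewrite ac bd.
- by rewrite ad bc setUC.
move: a1 b1 c1 d1 ab; rewrite !dotE => a1 b1 c1 d1 ab.
pose ux := a 0 0 - c 0 0; pose uy := a 0 1 - c 0 1.
pose vx := a 0 0 - d 0 0; pose vy := a 0 1 - d 0 1.
pose wx := a 0 0 + b 0 0; pose wy := a 0 1 + b 0 1.
have dE0 : d 0 0 = a 0 0 + b 0 0 - c 0 0 by lra.
have dE1 : d 0 1 = a 0 1 + b 0 1 - c 0 1 by lra.
have uw : ux * wx + uy * wy = 0.
  by rewrite /ux /uy /wx /wy; move: d1; rewrite dE0 dE1; nra.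
have vw : vx * wx + vy * wy = 0.
  by rewrite /vx /vy /wx /wy; move: d1; rewrite dE0 dE1; nra.
have uv : ux * vx + uy * vy = 0.
  by rewrite /ux /uy /vx /vy; move: d1; rewrite dE0 dE1; nra.
have ww : wx * wx + wy * wy = 1 by rewrite /wx /wy; nra.
(* u and v are both parallel to the normal of w, and orthogonal *)
have par x y : x * wx + y * wy = 0 ->
    x = (x * wy - y * wx) * wy /\ y = - (x * wy - y * wx) * wx.
  move=> xy; split.
    have -> : (x * wy - y * wx) * wy =
      x * (wx * wx + wy * wy) - wx * (x * wx + y * wy) by ring.
    by rewrite ww xy mulr1 mulr0 subr0.
  have -> : - (x * wy - y * wx) * wx =
    y * (wx * wx + wy * wy) - wy * (x * wx + y * wy) by ring.
  by rewrite ww xy mulr1 mulr0 subr0.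
have [ux' uy'] := par _ _ uw; have [vx' vy'] := par _ _ vw.
have : (ux * wy - uy * wx) * (vx * wy - vy * wx) = 0.
  set p := ux * wy - uy * wx in ux' uy' *; set q := vx * wy - vy * wx in vx' vy' *.
  have -> : p * q = p * q * (wx * wx + wy * wy) by rewrite ww mulr1.
  by move: uv; rewrite ux' uy' vx' vy' => <-; ring.
move/eqP; rewrite mulf_eq0 => /orP[/eqP p0|/eqP q0].
- left; rewrite p0 ?oppr0 !mul0r in ux' uy'.
  by split; apply: row2P; move: ux' uy'; rewrite /ux /uy; lra.
- right; rewrite q0 ?oppr0 !mul0r in vx' vy'.
  by split; apply: row2P; move: vx' vy'; rewrite /vx /vy; lra.
Qed.

Lemma eq_pairs_cases a b c d : a <> b -> [set a; b] = [set c; d] ->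
  (a = c /\ b = d) \/ (a = d /\ b = c).
Proof.
move=> ab E.
have Ha : [set c; d] a by rewrite -E; left.
have Hb : [set c; d] b by rewrite -E; right.
by case: Ha => Ea; case: Hb => Eb; [case: ab; rewrite Ea Eb|left|right|case: ab; rewrite Ea Eb].
Qed.

End plane.

(** * Energy bounds and short curves *)

Section curve_estimates.
Variable R : realType.
Implicit Types (c : H2curve R) (G : network R).
Local Notation mu := (@lebesgue_measure R).
Local Notation I := (`[0, 1]%classic : set R).
Let mI : measurable I. Proof. exact: measurable_itv. Qed.

Definition acc_sqr c : R :=
  \sum_(j < 2) ip (fun x => acc c x 0 j) (fun x => acc c x 0 j).

Lemma ip_acc_le c j : ip (fun x => acc c x 0 j) (fun x => acc c x 0 j) <= acc_sqr c.
Proof.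
by rewrite /acc_sqr (bigD1 j)//= lerDl; apply: sumr_ge0 => i _; exact: ip_ge0.
Qed.

Lemma acc_sqr_ge0 c : 0 <= acc_sqr c.
Proof. by apply: sumr_ge0 => i _; exact: ip_ge0. Qed.

Definition has_constant_speed c :=
  forall x, 0 <= x <= 1 -> enorm (vel c x) = curve_length c.

(** Multiplied out, the bending bound keeps its meaning at length zero, where it says that the
    acceleration has zero norm. The collapsed curve of a degenerate network is thus covered as
    well. *)
Definition energy_bounded (C : R) c :=
  curve_length c <= C /\ acc_sqr c <= C * curve_length c ^+ 3.

Lemma curve_length_ge0 c : 0 <= curve_length c.
Proof. by apply: Rintegral_ge0 => x _; exact: enorm_ge0. Qed.

Lemma integral_acc c :
  (\int[mu]_(x in I) (enorm (acc c x) ^+ 2)%:E = (acc_sqr c)%:E)%E.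
Proof.
have sa j := acc_square_integrable c j.
under eq_integral do rewrite enorm_sqr dotE -!expr2 EFinD.
have ms j : measurable_fun I (fun x => (acc c x 0 j ^+ 2)%:E).
  by apply/measurable_EFinP; apply: measurable_funX; exact: (sa j).1.
have s0 j x : I x -> (0 <= (acc c x 0 j ^+ 2)%:E)%E by rewrite lee_fin sqr_ge0.
rewrite (@ge0_integralD _ _ _ mu I mI _ _ (s0 0) (ms 0) (s0 1) (ms 1)).
have /= E0 := ipE (sa 0); have /= E1 := ipE (sa 1).
by rewrite E0 E1 -EFinD /acc_sqr sum2.
Qed.

Lemma curve_energyE c :
  curve_energy c = (acc_sqr c / curve_length c ^+ 3 + curve_length c)%:E.
Proof. by rewrite /curve_energy integral_acc -EFinM -EFinD mulrC. Qed.

Lemma curve_energy_ge0 c : (0 <= curve_energy c)%E.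
Proof.
by rewrite curve_energyE lee_fin addr_ge0 ?divr_ge0 ?exprn_ge0 ?acc_sqr_ge0 ?curve_length_ge0.
Qed.

Lemma energy_bounded_of_curve_energy (C : R) c : 0 < curve_length c ->
  (curve_energy c <= C%:E)%E -> energy_bounded C c.
Proof.
move=> L0; rewrite curve_energyE lee_fin => H.
have L30 : 0 < curve_length c ^+ 3 by rewrite exprn_gt0.
have A0 : 0 <= acc_sqr c / curve_length c ^+ 3.
  by rewrite divr_ge0 ?acc_sqr_ge0 ?(ltW L30).
by split; [lra|rewrite -ler_pdivrMr//; lra].
Qed.

(** A collapsed curve has zero velocity, so its acceleration integrates to zero over every
    [0, x]. *)
Lemma acc_sqr_eq0 c : has_constant_speed c -> curve_length c = 0 -> acc_sqr c = 0.
Proof.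
move=> cs L0.
have v0 x j : 0 <= x <= 1 -> vel c x 0 j = 0.
  move=> x01; apply/eqP; rewrite -normr_le0 -L0 -(cs x x01); exact: enorm_coord.
apply: big1 => j _; apply: ip_eq0; [exact: acc_square_integrable| |exact: acc_square_integrable].
move=> x x01; have /andP[x0 x1] := x01.
rewrite -(weak_derivative_Rintegral (@vel_continuous R c j)
  (acc_square_integrable c j) (vel_acc c j))//.
by rewrite !v0 ?subrr// lexx ler01.
Qed.

Lemma energy_bounded_of_Fbar (C : R) G : 0 <= C -> (Fbar G <= C%:E)%E ->
  (theta_network G \/ degenerate_theta_network G) /\
  forall i, energy_bounded C (curve G i).
Proof.
move=> C0 FC.
have cs i : has_constant_speed (curve G i) by exact: constant_speed.
have [thdeg sumC] : (theta_network G \/ degenerate_theta_network G) /\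
    (\sum_(i < 3 | (0 < curve_length (curve G i))%R) curve_energy (curve G i) <= C%:E)%E.
  (* All lengths of a Theta-network are positive, so both finite cases of [Fbar] are the sum over
     curves of positive length. *)
  move: FC; rewrite /Fbar; case: asboolP => [th|nth].
    move=> H; split; first by left.
    have [reg _ _] := th; rewrite (eq_bigl xpredT)// => i.
    rewrite lt_def curve_length_ge0 andbT -(cs i 0) ?lexx ?ler01//.
    by apply: reg; rewrite lexx ler01.
  by case: asboolP => [dg H|_]; [split=> //; right|rewrite leye_eq].
split=> // i; have [L0|] := ltP 0 (curve_length (curve G i)).
  apply: energy_bounded_of_curve_energy => //; apply: le_trans sumC.
  by rewrite (bigD1 i)//= leeDl// sume_ge0// => k _; exact: curve_energy_ge0.
move=> Lle; have L0 : curve_length (curve G i) = 0.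
  by apply/le_anti; rewrite Lle curve_length_ge0.
by split; rewrite ?acc_sqr_eq0// L0// expr0n mulr0.
Qed.

Lemma vel_dist (C : R) c (x y : R) : energy_bounded C c ->
  0 <= x <= 1 -> 0 <= y <= 1 ->
  dot (vel c y - vel c x) (vel c y - vel c x) <= C * curve_length c ^+ 3.
Proof.
move=> [_ cC] x01 y01; apply: le_trans cC.
have xy : `|y - x| <= 1 by rewrite ler_norml; apply/andP; split; lra.
have H j : (vel c y 0 j - vel c x 0 j) ^+ 2 <=
    ip (fun x => acc c x 0 j) (fun x => acc c x 0 j).
  apply: le_trans (vel_hoelder (lexx _) x01 y01) _.
  by rewrite ler_piMr// ip_ge0.
rewrite dotE !mxE -!expr2 /acc_sqr sum2; exact: lerD.
Qed.

(** The chord is the mean of the velocity over [0, 1], hence as close to the initial velocity as the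
    velocity itself. *)
Lemma chord_dist (C : R) c : energy_bounded C c ->
  dot (pos c 1 - pos c 0 - vel c 0) (pos c 1 - pos c 0 - vel c 0)
    <= C * curve_length c ^+ 3.
Proof.
move=> [_ cC]; apply: le_trans cC.
have z01 : 0 <= (0 : R) <= 1 by rewrite lexx ler01.
have H j : (pos c 1 0 j - pos c 0 0 j - vel c 0 0 j) ^+ 2 <=
    ip (fun x => acc c x 0 j) (fun x => acc c x 0 j).
  set A := ip _ _; have A0 : 0 <= A by exact: ip_ge0.
  have sv := sqi_continuous (@vel_continuous R c j).
  have s1 := @sqi_cst R (vel c 0 0 j).
  have sw := sqiB sv s1.
  rewrite (weak_derivative_Rintegral (@pos_continuous R c j) sv (pos_vel c j))//.
  have -> : \int[mu]_(t in `[0, 1]) vel c t 0 j - vel c 0 0 j =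
      \int[mu]_(t in `[0, 1]) (vel c t 0 j - vel c 0 0 j).
    rewrite RintegralB//; [|exact: sqi_integrable|exact: sqi_integrable].
    by rewrite Rintegral_cst//= (lebesgue_I R) mulr1.
  apply: le_trans (Rintegral_sqr_le sw _ _ _) _ => //.
  rewrite subr0 mulr1 -(sqr_sqrtr A0); apply: ip_le_sqr => // x x01.
  apply: ler_norm_sqr; rewrite ?sqrtr_ge0// sqr_sqrtr//.
  apply: le_trans (vel_hoelder (lexx _) z01 x01) _.
  rewrite ler_piMr// subr0; have /andP[x0 x1] := x01; by rewrite ger0_norm.
rewrite dotE !mxE -!expr2 /acc_sqr sum2; exact: lerD.
Qed.

End curve_estimates.

Section three.

Lemma sum_uniq3 (V : zmodType) (F : 'I_3 -> V) (i j k : 'I_3) : uniq [:: i; j; k] ->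
  \sum_(t < 3) F t = F i + F j + F k.
Proof.
rewrite /= !inE negb_or andbT => /andP[/andP[ij ik] jk].
rewrite (bigD1 i)//= (bigD1 j) 1?eq_sym//= (bigD1 k)/=; last first.
  by rewrite !(eq_sym k) ik jk.
rewrite big1 ?addr0 ?addrA// => t.
by case: i j k t ij ik jk => [[|[|[|//]]] ?] [[|[|[|//]]] ?] [[|[|[|//]]] ?] [[|[|[|//]]] ?].
Qed.

Lemma exists_third (i j : 'I_3) : i != j -> exists k, uniq [:: i; j; k].
Proof.
by case: i j => [[|[|[|//]]] ?] [[|[|[|//]]] ?] // _;
  first [by exists (inord 0); rewrite /= !inE -!val_eqE /= !inordK
        |by exists (inord 1); rewrite /= !inE -!val_eqE /= !inordK
        |by exists (inord 2); rewrite /= !inE -!val_eqE /= !inordK].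
Qed.

Lemma exists_others (k : 'I_3) : exists i j, uniq [:: i; j; k].
Proof.
have [i ik] : exists i : 'I_3, i != k.
  case: k => [[|k] ?]; first by exists (inord 1); rewrite -val_eqE /= inordK.
  by exists (inord 0); rewrite -val_eqE /= inordK.
have [j ikj] := exists_third ik; exists i, j.
by move: ikj; rewrite /= !inE !negb_or !andbT (eq_sym k j) => /andP[/andP[-> ->] ->].
Qed.

End three.

Section network_geometry.
Variable R : realType.
Implicit Types (c : H2curve R) (G : network R) (a b : 'rV[R]_2).

Lemma tau_coord c x j : tau c x 0 j = (enorm (vel c x))^-1 * vel c x 0 j.
Proof. by rewrite mxE. Qed.

Lemma dot_tau c x : enorm (vel c x) != 0 -> dot (tau c x) (tau c x) = 1.
Proof.
move=> v0; rewrite dotE !tau_coord -[RHS](mulVf (expf_neq0 2 v0)) {2}enorm_sqr dotE.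
by field.
Qed.

Lemma vel_coord c x j : enorm (vel c x) != 0 ->
  vel c x 0 j = enorm (vel c x) * tau c x 0 j.
Proof. by move=> v0; rewrite tau_coord mulrA mulfV// mul1r. Qed.

Lemma dot_of_sum0 a b d : dot a a = 1 -> dot b b = 1 -> dot d d = 1 ->
  a + b + d = 0 -> dot a b = - (1 / 2).
Proof.
move=> a1 b1 d1 /rowP abd; have := abd 0; have := abd 1; rewrite !mxE => e1 e0.
move: a1 b1 d1; rewrite !dotE.
have -> : d 0 0 = - (a 0 0 + b 0 0) by lra.
have -> : d 0 1 = - (a 0 1 + b 0 1) by lra.
by nra.
Qed.

(** With zero chord, the squared initial speed L^2 is itself at most C L^3. *)
Lemma closed_curve_length (C : R) c : has_constant_speed c -> energy_bounded C c ->
  pos c 0 = pos c 1 -> 0 < curve_length c -> 1 <= C * curve_length c.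
Proof.
move=> cs cE p01 L0; have := chord_dist cE.
have := enorm_sqr (vel c 0); rewrite cs ?lexx ?ler01//.
rewrite !dotE !mxE p01; set L := curve_length c in L0 * => E H.
have : L ^+ 2 <= C * L ^+ 3 by rewrite E; lra.
have -> : C * L ^+ 3 = L ^+ 2 * (C * L) by ring.
by rewrite -[leLHS]mulr1 ler_pM2l ?exprn_gt0.
Qed.

Lemma theta_length_gt0 G i : theta_network G -> 0 < curve_length (curve G i).
Proof.
move=> [reg _ _]; rewrite lt_def curve_length_ge0 andbT.
rewrite -(@constant_speed R G i 0) ?lexx ?ler01//; apply: reg.
by rewrite lexx ler01.
Qed.

Lemma theta_dot_tau G i j : theta_network G -> i != j ->
  dot (tau (curve G i) 0) (tau (curve G j) 0) = - (1 / 2).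
Proof.
move=> [reg s0 _] ij; have [k u] := exists_third ij.
have n1 t : dot (tau (curve G t) 0) (tau (curve G t) 0) = 1.
  by apply: dot_tau; apply: reg; rewrite lexx ler01.
apply: (dot_of_sum0 (n1 i) (n1 j) (n1 k)); rewrite -s0.
by rewrite (sum_uniq3 (fun t => tau (curve G t) 0) u).
Qed.

(* The two curves share their chord D, which is within sqrt(C L^3) of both
   initial velocities v, w, while |v - w|^2 = L^2 + L'^2 + L L'. *)
Lemma theta_not_two_short (C : R) G i j : theta_network G -> i != j ->
  (forall k, energy_bounded C (curve G k)) ->
  2 * C * curve_length (curve G i) < 1 -> 1 <= 2 * C * curve_length (curve G j).
Proof.
move=> th ij Eb Hi; rewrite leNgt; apply/negP => Hj.
have Li := theta_length_gt0 i th; have Lj := theta_length_gt0 j th.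
have z01 : 0 <= (0 : R) <= 1 by rewrite lexx ler01.
have ei := @constant_speed R G i 0 z01; have ej := @constant_speed R G j 0 z01.
have d := theta_dot_tau th ij.
have := chord_dist (Eb i); have := chord_dist (Eb j).
rewrite (junction0 G j i) (junction1 G j i).
have := enorm_sqr (vel (curve G i) 0); have := enorm_sqr (vel (curve G j) 0).
have vij : dot (vel (curve G i) 0) (vel (curve G j) 0) =
    - (1 / 2) * (curve_length (curve G i) * curve_length (curve G j)).
  rewrite -d !dotE !(@vel_coord (curve G i)) ?(@vel_coord (curve G j)) ?ei ?ej ?gt_eqF//.
  by ring.
move: vij; rewrite ei ej.
set L := curve_length (curve G i) in Li Hi *; set L' := curve_length (curve G j) in Lj Hj *.
rewrite !dotE !mxE.
set v0 := vel (curve G i) 0 0 0; set v1 := vel (curve G i) 0 0 1.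
set w0 := vel (curve G j) 0 0 0; set w1 := vel (curve G j) 0 0 1.
set D0 := pos _ 1 0 0 - _; set D1 := pos _ 1 0 1 - _.
move=> vw ww vv Hw Hv.
(* Below the threshold 1 / (2 C) the two chord errors give |v - w|^2 <= L^2 + L'^2, and the extra
   positive term L L' is the contradiction. *)
have h1 : C * L ^+ 3 <= L ^+ 2 / 2.
  have -> : C * L ^+ 3 = L ^+ 2 / 2 * (2 * C * L) by field.
  by rewrite -[leRHS]mulr1 ler_wpM2l ?divr_ge0 ?sqr_ge0// ltW.
have h2 : C * L' ^+ 3 <= L' ^+ 2 / 2.
  have -> : C * L' ^+ 3 = L' ^+ 2 / 2 * (2 * C * L') by field.
  by rewrite -[leRHS]mulr1 ler_wpM2l ?divr_ge0 ?sqr_ge0// ltW.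
have LL : 0 < L * L' by rewrite mulr_gt0.
have h3 : (v0 - w0) ^+ 2 + (v1 - w1) ^+ 2 = L ^+ 2 + L' ^+ 2 + L * L'.
  rewrite ww vv; have -> : L * L' = - 2 * (v0 * w0 + v1 * w1) by rewrite vw; field.
  by ring.
have g0 := sqr_ge0 ((D0 - v0) + (D0 - w0)); have g1 := sqr_ge0 ((D1 - v1) + (D1 - w1)).
have : (v0 - w0) ^+ 2 + (v1 - w1) ^+ 2 <= 2 * ((D0 - v0) * (D0 - v0) + (D1 - v1) * (D1 - v1))
    + 2 * ((D0 - w0) * (D0 - w0) + (D1 - w1) * (D1 - w1)).
  by clear - g0 g1; nra.
by rewrite h3; clear - Hw Hv h1 h2 LL; lra.
Qed.

End network_geometry.

(** * Limits of networks *)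

Section limit.
Variable R : realType.

(** Pigeonhole along an ultrafilter: it fixes one labelling of the curves for degenerate
    networks. *)
Lemma ultra_exists (T : finType) (S : Type) (U : set_system S) (P : T -> set S) :
  UltraFilter U -> U [set n | exists t, P t n] -> exists t, U (P t).
Proof.
move=> UU UP; apply: contrapT => nP.
have H : \forall n \near U, forall t, (~` P t) n.
  apply: filter_forall => t; have [UPt|//] := in_ultra_setVsetC (P t) UU.
  by exfalso; apply: nP; exists t.
have FU : Filter U by typeclasses eauto.
have /(@filter_ex _ U)[n [[t Pt] nPt]] := @filterI _ U FU _ _ UP H.
exact: nPt Pt.
Qed.

Section along_filter.
Variables (S : Type) (U : set_system S).
Hypothesis PU : ProperFilter U.
Implicit Types (f g : S -> R).

(** Stated for any proper filter, as it serves both along an ultrafilter and along [\oo]. *)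
Lemma lim_eq f g (a b : R) : f @ U --> a -> g @ U --> b ->
  U [set n | f n = g n] -> a = b.
Proof.
move=> fa gb fg; apply: (cvg_unique (@Rhausdorff R) fa).
apply: cvg_trans gb; apply: near_eq_cvg.
by apply: filterS fg => n /= ->.
Qed.

Lemma lim_rV_eq (f g : S -> 'rV[R]_2) (a b : 'rV[R]_2) :
  (forall j, (fun n => f n 0 j) @ U --> a 0 j) ->
  (forall j, (fun n => g n 0 j) @ U --> b 0 j) ->
  U [set n | f n = g n] -> a = b.
Proof.
move=> fa gb fg; apply/rowP => j; apply: lim_eq (fa j) (gb j) _.
by apply: filterS fg => n /= ->.
Qed.

Lemma dot_cvg (f g : S -> 'rV[R]_2) (a b : 'rV[R]_2) :
  (forall j, (fun n => f n 0 j) @ U --> a 0 j) ->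
  (forall j, (fun n => g n 0 j) @ U --> b 0 j) ->
  (fun n => dot (f n) (g n)) @ U --> dot a b.
Proof.
move=> fa gb; rewrite dotE; under eq_fun do rewrite dotE.
by apply: cvgD; apply: cvgM; [exact: fa|exact: gb|exact: fa|exact: gb].
Qed.

Lemma enorm_cvg (f : S -> 'rV[R]_2) (a : 'rV[R]_2) :
  (forall j, (fun n => f n 0 j) @ U --> a 0 j) ->
  (fun n => enorm (f n)) @ U --> enorm a.
Proof.
move=> fa; rewrite /enorm; apply: continuous_cvg; first exact: sqrt_continuous.
exact: dot_cvg.
Qed.

End along_filter.

(** The conclusion concerns the fixed network [G], so the limits may be taken along one ultrafilter,
    with no further subsequence. *)
Lemma theta_or_degenerate_limit (H : nat -> network R) (G : network R) (C : R) :
  0 < C -> (forall n i, energy_bounded C (curve (H n) i)) ->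
  (forall i j x, 0 <= x <= 1 ->
    (fun n => pos (curve (H n) i) x 0 j) @ \oo --> pos (curve G i) x 0 j) ->
  (forall i j x, 0 <= x <= 1 ->
    (fun n => vel (curve (H n) i) x 0 j) @ \oo --> vel (curve G i) x 0 j) ->
  (forall n, theta_network (H n) \/ degenerate_theta_network (H n)) ->
  theta_network G \/ degenerate_theta_network G.
Proof.
move=> C0 Eb Hpos Hvel Hth.
have [U [UU Uoo]] := ultraFilterLemma (eventually_filter : ProperFilter \oo).
have PU : ProperFilter U by typeclasses eauto.
have FU : Filter U by typeclasses eauto.
have z01 : 0 <= (0 : R) <= 1 by rewrite lexx ler01.
have o01 : 0 <= (1 : R) <= 1 by rewrite lexx ler01.
pose L n i := curve_length (curve (H n) i); pose l i := curve_length (curve G i).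
have upos i x : 0 <= x <= 1 -> forall j,
    (fun n => pos (curve (H n) i) x 0 j) @ U --> pos (curve G i) x 0 j.
  by move=> x01 j; apply: cvg_trans (Hpos i j x x01); apply: cvg_app.
have uvel i x : 0 <= x <= 1 -> forall j,
    (fun n => vel (curve (H n) i) x 0 j) @ U --> vel (curve G i) x 0 j.
  by move=> x01 j; apply: cvg_trans (Hvel i j x x01); apply: cvg_app.
have speedH n i x : 0 <= x <= 1 -> enorm (vel (curve (H n) i) x) = L n i.
  exact: constant_speed.
have speedG i x : 0 <= x <= 1 -> enorm (vel (curve G i) x) = l i.
  exact: constant_speed.
have len i : (fun n => L n i) @ U --> l i.
  have := enorm_cvg PU (uvel i 0 z01); rewrite speedG//.
  by under eq_fun do rewrite speedH//.
have utau i x : 0 <= x <= 1 -> l i != 0 -> forall j,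
    (fun n => tau (curve (H n) i) x 0 j) @ U --> tau (curve G i) x 0 j.
  move=> x01 li j; rewrite tau_coord speedG//.
  under eq_fun do rewrite tau_coord speedH//.
  apply: cvgM; last exact: uvel.
  by apply: cvgV => //; exact: len.
have reg i : l i != 0 -> regular (curve G i) by move=> li x x01; rewrite speedG.
have tau1 i x : 0 <= x <= 1 -> l i != 0 ->
    dot (tau (curve G i) x) (tau (curve G i) x) = 1.
  by move=> x01 li; apply: dot_tau; rewrite speedG.
have cst (k : 'I_3) (x : R) : U [set n | pos (curve (H n) k) x = pos (curve (H n) k) 0] ->
    0 <= x <= 1 -> pos (curve G k) x = pos (curve G k) 0.
  by move=> E x01; apply: (lim_rV_eq PU (upos k x x01) (upos k 0 z01)).
(* Either Theta-networks or degenerate ones fill a set of U, and the two types are never mixed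
   afterwards. *)
have [Uth|Unth] := in_ultra_setVsetC [set n | theta_network (H n)] UU; last first.
  pose deg (t : 'I_3 * 'I_3 * 'I_3) := [set n | uniq [:: t.1.1; t.1.2; t.2] /\
    let c1 := curve (H n) t.1.1 in let c2 := curve (H n) t.1.2 in
    let c3 := curve (H n) t.2 in
    [/\ regular c1 /\ regular c2,
        exists P : 'rV[R]_2,
          (forall x : R, 0 <= x <= 1 -> pos c3 x = P) /\
          [/\ pos c1 0 = P, pos c1 1 = P, pos c2 0 = P & pos c2 1 = P],
        angle (tau c1 0) (tau c2 0) = 2 * pi / 3 &
        [set tau c1 0; tau c2 0] = [set tau c1 1; tau c2 1]]].
  have [[[i j] k] Ud] : exists t, U (deg t).
    apply: ultra_exists; apply: filterS Unth => n nth.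
    by have [//|[i [j [k d]]]] := Hth n; exists (i, j, k).
  have Ud1 : U [set n | uniq [:: i; j; k]] by apply: filterS Ud => n [].
  have u : uniq [:: i; j; k] by have /(@filter_ex _ U)[?] := Ud1.
  have closed t : t \in [:: i; j] ->
      U [set n | [/\ 0 < L n t, pos (curve (H n) t) 0 = pos (curve (H n) k) 0 &
                    pos (curve (H n) t) 1 = pos (curve (H n) k) 0]].
    rewrite !inE => /orP[] /eqP ->; apply: filterS Ud => n /= [_ [[r1 r2] [P [cP [p1 p2 p3 p4]]] _ _]].
    - split; [|by rewrite p1 cP|by rewrite p2 cP].
      by rewrite lt_def curve_length_ge0 andbT -(speedH n i 0 z01) r1.
    - split; [|by rewrite p3 cP|by rewrite p4 cP].
      by rewrite lt_def curve_length_ge0 andbT -(speedH n j 0 z01) r2.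
  have lpos t : t \in [:: i; j] -> l t != 0.
    (* The two closed curves have length at least 1 / C, and this bound survives the limit. *)
    move=> /closed Ut; suff : C^-1 <= l t.
      by move=> H1; rewrite gt_eqF// (lt_le_trans _ H1)// invr_gt0.
    apply: (cvgr_to_ge (len t)); apply: filterS Ut => n [Ln p0 p1].
    rewrite -[leLHS]mulr1 ler_pdivrMl//.
    apply: closed_curve_length => //; first exact: constant_speed.
    by rewrite p0 p1.
  have li : l i != 0 by apply: lpos; rewrite !inE eqxx.
  have lj : l j != 0 by apply: lpos; rewrite !inE eqxx orbT.
  have ends t : t \in [:: i; j] -> pos (curve G t) 0 = pos (curve G k) 0 /\
      pos (curve G t) 1 = pos (curve G k) 0.
    move=> /closed Ut; split.
    - by apply: (lim_rV_eq PU (upos t 0 z01) (upos k 0 z01)); apply: filterS Ut => n [].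
    - by apply: (lim_rV_eq PU (upos t 1 o01) (upos k 0 z01)); apply: filterS Ut => n [].
  have Udot : U [set n | dot (tau (curve (H n) i) 0) (tau (curve (H n) j) 0) = - (1 / 2)].
    apply: filterS Ud => n /= [_ [[r1 r2] _ ang _]].
    by apply/angle_2pi3 => //; apply: dot_tau; [exact: r1|exact: r2].
  right; exists i, j, k; split=> //=; split; first by split; exact: reg.
  - exists (pos (curve G k) 0); split.
      move=> x x01; apply: cst => //.
      by apply: filterS Ud => n /= [_ [_ [P [cP _]] _ _]]; rewrite !cP.
    have [e1 e2] := ends i (ltac:(by rewrite !inE eqxx)).
    have [e3 e4] := ends j (ltac:(by rewrite !inE eqxx orbT)).
    by [].
  - apply/angle_2pi3; [exact: tau1|exact: tau1|].
    by apply: (lim_eq PU (dot_cvg PU (utau i 0 z01 li) (utau j 0 z01 lj)) (cvg_cst _)).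
  (* The tangents at 1 are those at 0, kept or swapped: their product -1/2 makes them distinct, and
     U decides between the two matchings. *)
  - have Upair : U [set n | (tau (curve (H n) i) 0 = tau (curve (H n) i) 1 /\
        tau (curve (H n) j) 0 = tau (curve (H n) j) 1) \/
        (tau (curve (H n) i) 0 = tau (curve (H n) j) 1 /\
        tau (curve (H n) j) 0 = tau (curve (H n) i) 1)].
      apply: filterS (@filterI _ U FU _ _ Ud Udot) => n [[_ [[r1 _] _ _ E]] D] /=.
      apply: eq_pairs_cases => // ab; move: D; rewrite /= -ab dot_tau; last exact: r1.
      lra.
    have [U1|U2] := in_ultra_setVsetC [set n |
        tau (curve (H n) i) 0 = tau (curve (H n) i) 1 /\
        tau (curve (H n) j) 0 = tau (curve (H n) j) 1] UU.
    + have -> : tau (curve G i) 0 = tau (curve G i) 1.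
        apply: (lim_rV_eq PU (utau i 0 z01 li) (utau i 1 o01 li)).
        by apply: filterS U1 => n [].
      have -> // : tau (curve G j) 0 = tau (curve G j) 1.
      apply: (lim_rV_eq PU (utau j 0 z01 lj) (utau j 1 o01 lj)).
      by apply: filterS U1 => n [].
    + have {}U2 : U [set n | tau (curve (H n) i) 0 = tau (curve (H n) j) 1 /\
          tau (curve (H n) j) 0 = tau (curve (H n) i) 1].
        by apply: filterS (@filterI _ U FU _ _ Upair U2) => n /= [[|]].
      rewrite setUC; have -> : tau (curve G j) 0 = tau (curve G i) 1.
        apply: (lim_rV_eq PU (utau j 0 z01 lj) (utau i 1 o01 li)).
        by apply: filterS U2 => n [].
      have -> // : tau (curve G i) 0 = tau (curve G j) 1.
      apply: (lim_rV_eq PU (utau i 0 z01 li) (utau j 1 o01 lj)).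
      by apply: filterS U2 => n [].
have [lall|] := pselect (forall i, l i != 0).
  left; split; first by move=> i; exact: reg.
  - apply/rowP => j; rewrite summxE mxE.
    have cv : (fun n => \sum_(i < 3) tau (curve (H n) i) 0 0 j) @ U -->
        \sum_(i < 3) tau (curve G i) 0 0 j.
      by apply: cvg_big => [|i _]; [exact: add_continuous|exact: utau].
    apply: (lim_eq PU cv (cvg_cst 0)); apply: filterS Uth => n /= [_ s0 _].
    by rewrite -summxE s0 mxE.
  - apply/rowP => j; rewrite summxE mxE.
    have cv : (fun n => \sum_(i < 3) tau (curve (H n) i) 1 0 j) @ U -->
        \sum_(i < 3) tau (curve G i) 1 0 j.
      by apply: cvg_big => [|i _]; [exact: add_continuous|exact: utau].
    apply: (lim_eq PU cv (cvg_cst 0)); apply: filterS Uth => n /= [_ _ s1].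
    by rewrite -summxE s1 mxE.
move=> /existsNP[k /negP/negPn/eqP lk0].
(* Were two limit lengths zero, some Theta-network of the sequence would have both lengths below 1 /
   (2 C). *)
have lpos t : t != k -> l t != 0.
  move=> tk; apply/eqP => lt0.
  have small i : l i = 0 -> U [set n | 2 * C * L n i < 1].
    move=> li0; have cl : (fun n => 2 * C * L n i) @ U --> 2 * C * l i.
      by apply: cvgMr; exact: len.
    have c1 : 2 * C * l i < 1 by rewrite li0 mulr0.
    exact: cvgr_lt cl _ c1.
  have /(@filter_ex _ U)[n [[th s1] s2]] :=
    @filterI _ U FU _ _ (@filterI _ U FU _ _ Uth (small t lt0)) (small k lk0).
  have := theta_not_two_short th tk (Eb n) s1; rewrite leNgt.
  by move/negP; apply; exact: s2.
have [i [j u]] := exists_others k.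
have [ik jk ij] : [/\ i != k, j != k & i != j].
  by move: u; rewrite /= !inE !negb_or andbT => /andP[/andP[-> ->] ->].
have li := lpos i ik; have lj := lpos j jk.
have cstk x : 0 <= x <= 1 -> pos (curve G k) x = pos (curve G k) 0.
  move=> x01; apply/rowP => m; apply/eqP; rewrite -subr_eq0 -sqrf_eq0.
  (* With velocity bound 0, the Hoelder estimate for positions says that the curve is constant. *)
  have vb : velocity_bounded 0 (curve G k).
    by move=> j' y y01; apply: le_trans (enorm_coord _ _) _; rewrite speedG// lk0.
  have := pos_hoelder m vb z01 x01; rewrite expr0n mul0r => h.
  by apply/eqP/le_anti; rewrite h sqr_ge0.
have p1 t : pos (curve G t) 1 = pos (curve G k) 0.
  by rewrite (junction1 G t k) cstk.
have dij : dot (tau (curve G i) 0) (tau (curve G j) 0) = - (1 / 2).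
  apply: (lim_eq PU (dot_cvg PU (utau i 0 z01 li) (utau j 0 z01 lj)) (cvg_cst _)).
  by apply: filterS Uth => n th; exact: theta_dot_tau.
right; exists i, j, k; split=> //=; split; first by split; exact: reg.
- exists (pos (curve G k) 0); split; first exact: cstk.
  by split; rewrite ?p1//; exact: junction0.
- by apply/angle_2pi3; [exact: tau1|exact: tau1|].
apply: eq_pairs_of_sum; [exact: tau1|exact: tau1|exact: tau1|exact: tau1|by []|].
move=> m; apply/eqP; rewrite -subr_eq0 -sqrf_eq0.
(* In a Theta-network this sum is minus the tangent of the collapsing curve. That tangent divides by
   a speed tending to 0, so only the difference of its two end values is estimated. *)
pose D n x := tau (curve (H n) i) x 0 m + tau (curve (H n) j) x 0 m.
have cD x : 0 <= x <= 1 -> (fun n => D n x) @ U -->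
    tau (curve G i) x 0 m + tau (curve G j) x 0 m.
  by move=> x01; apply: cvgD; exact: utau.
have cDD : (fun n => (D n 0 - D n 1) * (D n 0 - D n 1)) @ U -->
    (tau (curve G i) 0 0 m + tau (curve G j) 0 0 m -
      (tau (curve G i) 1 0 m + tau (curve G j) 1 0 m)) *
    (tau (curve G i) 0 0 m + tau (curve G j) 0 0 m -
      (tau (curve G i) 1 0 m + tau (curve G j) 1 0 m)).
  by apply: cvgM; apply: cvgB; exact: cD.
rewrite expr2; apply/eqP/le_anti; rewrite -{2}expr2 sqr_ge0 andbT.
(* The squared difference is at most C L^3 / L^2 = C L, where L is the length of the collapsing
   curve. *)
have cL : (fun n => C * L n k) @ U --> (0 : R).
  by rewrite -(mulr0 C) -lk0; apply: cvgMr; exact: len.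
apply: (ler_cvg_to cDD cL); apply: filterS Uth => n th.
have Lk := theta_length_gt0 k th.
have eD x : x = 0 \/ x = 1 -> D n x = - tau (curve (H n) k) x 0 m.
  have [_ s0 s1] := th; move=> [->|->].
  - move/rowP/(_ m): s0; rewrite (sum_uniq3 (fun t => tau (curve (H n) t) 0) u) !mxE /D !tau_coord.
    by lra.
  - move/rowP/(_ m): s1; rewrite (sum_uniq3 (fun t => tau (curve (H n) t) 1) u) !mxE /D !tau_coord.
    by lra.
rewrite !eD; [|by right|by left].
rewrite !tau_coord !speedH//.
have := vel_dist (Eb n k) z01 o01; rewrite -/(L n k).
have := dot_ge0 (vel (curve (H n) k) 1 - vel (curve (H n) k) 0).
set w := vel _ 1 - _.
have wm : (vel (curve (H n) k) 1 0 m - vel (curve (H n) k) 0 0 m) ^+ 2 <= dot w w.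
  have := enorm_coord w m; rewrite !mxE -(enorm_sqr w) => h.
  by rewrite -(real_normK (num_real _)) ler_sqr ?nnegrE ?enorm_ge0.
move=> _ dw; have L0 : L n k != 0 by rewrite gt_eqF.
have -> : (- ((L n k)^-1 * vel (curve (H n) k) 0 0 m) -
     - ((L n k)^-1 * vel (curve (H n) k) 1 0 m)) *
    (- ((L n k)^-1 * vel (curve (H n) k) 0 0 m) -
     - ((L n k)^-1 * vel (curve (H n) k) 1 0 m)) =
  (vel (curve (H n) k) 1 0 m - vel (curve (H n) k) 0 0 m) ^+ 2 / L n k ^+ 2.
  by field.
rewrite ler_pdivrMr ?exprn_gt0//.
by apply: le_trans wm _; apply: le_trans dw _; rewrite exprS mulrA.
Qed.

End limit.

(** * From the energy bound to the limit network *)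

Lemma limn_esup_lty (R : realType) (u : nat -> \bar R) : (limn_esup u < +oo)%E ->
  exists (C : R) (N : nat), 0 < C /\ forall n, (N <= n)%N -> (u n <= C%:E)%E.
Proof.
rewrite /limn_esup limf_esupE => /ereal_inf_lt[_ [V [N _ NV] <-] supV].
have uV n : (N <= n)%N -> (u n <= ereal_sup (u @` V))%E.
  by move=> Nn; apply: ereal_sup_ubound; exists n => //; exact: NV.
move: supV uV; case: ereal_sup => [r| |] // _ uV.
- exists (Num.max r 1), N; split; first by rewrite lt_max ltr01 orbT.
  by move=> n /uV /le_trans; apply; rewrite lee_fin le_max lexx.
- by exists 1, N; split=> // n /uV /le_trans; apply; rewrite leNye.
Qed.

(** The speed is only assumed independent of the parameter, a property that passes to pointwise
    limits; its value is then the length, by integration over [0, 1]. *)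
Lemma network_of_curves (R : realType) (d : 'I_3 -> H2curve R) :
  (forall i j, pos (d i) 0 = pos (d j) 0) -> (forall i j, pos (d i) 1 = pos (d j) 1) ->
  (forall i x y, 0 <= x <= 1 -> 0 <= y <= 1 -> enorm (vel (d i) x) = enorm (vel (d i) y)) ->
  exists G : network R, curve G = d.
Proof.
move=> d0 d1 dv; unshelve eexists (@MkNetwork R d d0 d1 _) => //.
move=> i x x01; have z01 : 0 <= (0 : R) <= 1 by rewrite lexx ler01.
rewrite /curve_length (_ : \int[_]_(_ in _) _ =
  \int[lebesgue_measure]_(t in `[0, 1]) enorm (vel (d i) 0)).
  by rewrite Rintegral_cst//= (lebesgue_I R) mulr1; exact: dv.
by apply: eq_Rintegral => t; rewrite inE/= in_itv/= => t01; exact: dv.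
Qed.

Theorem proposition3p4 (R : realType) (G : nat -> network R)
  (origin : forall n, (forall i, pos (curve (G n) i) 0 = 0) \/
                      (forall i, pos (curve (G n) i) 1 = 0))
  (bounded : (limn_esup (fun n => Fbar (G n)) < +oo)%E) :
  exists (s : nat -> nat) (Glim : network R),
    [/\ {homo s : m n / (m < n)%N},
        forall i : 'I_3,
          weak_H2_cvg (fun n => curve (G (s n)) i) (curve Glim i),
        forall (alpha : R), 0 < alpha < 1 / 2 -> forall i : 'I_3,
          strong_C1alpha_cvg alpha (fun n => curve (G (s n)) i) (curve Glim i) &
        theta_network Glim \/ degenerate_theta_network Glim].
Proof.
(* The limsup controls only a tail, so the first N networks are dropped and the subsequence found
   below is shifted by N. *)
have [C [N [C0 FC]]] := limn_esup_lty bounded.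
have FE n := energy_bounded_of_Fbar (ltW C0) (FC _ (leq_addr n N)).
have z01 : 0 <= (0 : R) <= 1 by rewrite lexx ler01.
have o01 : 0 <= (1 : R) <= 1 by rewrite lexx ler01.
have LC n i : curve_length (curve (G (N + n)) i) <= C by have [] := (FE n).2 i.
(* From int |gamma_xx|^2 <= C L^3 and L <= C. *)
have accK n i j : ip (fun x => acc (curve (G (N + n)) i) x 0 j)
    (fun x => acc (curve (G (N + n)) i) x 0 j) <= C * C ^+ 3.
  apply: le_trans (ip_acc_le _ j) _; apply: le_trans ((FE n).2 i).2 _.
  by rewrite ler_wpM2l ?(ltW C0)// lerXn2r ?nnegrE ?curve_length_ge0 ?(ltW C0).
have velC n i : velocity_bounded C (curve (G (N + n)) i).
  move=> j x x01; apply: le_trans (enorm_coord _ j) _.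
  by rewrite (@constant_speed R (G (N + n)) i x x01).
have posC n i j x : 0 <= x <= 1 -> `|pos (curve (G (N + n)) i) x 0 j| <= C.
  (* Whichever junction is at the origin, no coordinate moves farther than the speed bound C over a
     parameter interval of length at most 1. *)
  move=> x01; have near0 y : 0 <= y <= 1 -> pos (curve (G (N + n)) i) y = 0 ->
      `|pos (curve (G (N + n)) i) x 0 j| <= C.
    move=> y01 py; apply: ler_norm_sqr; first exact: ltW.
    have := pos_hoelder j (velC n i) y01 x01; rewrite py mxE subr0 => /le_trans; apply.
    rewrite ler_piMr ?sqr_ge0// ler_norml.
    by move: x01 y01 => /andP[x0 x1] /andP[y0 y1]; apply/andP; split; lra.
  by have [p0|p1] := origin (N + n)%N; [exact: near0 z01 (p0 i)|exact: near0 o01 (p1 i)].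
have K0 : 0 <= C * C ^+ 3 by rewrite mulr_ge0 ?exprn_ge0 ?(ltW C0).
have [s [d [smono sd]]] := @H2_compactness R _ (fun n i => curve (G (N + n)) i) _ _
  K0 accK velC posC.
have cpos i j x : 0 <= x <= 1 ->
    (fun n => pos (curve (G (N + s n)) i) x 0 j) @ \oo --> pos (d i) x 0 j.
  by move=> x01; have [up _ _ _] := sd i; exact: (ucvg_cvg (up j)).
have cvel i j x : 0 <= x <= 1 ->
    (fun n => vel (curve (G (N + s n)) i) x 0 j) @ \oo --> vel (d i) x 0 j.
  by move=> x01; have [_ uv _ _] := sd i; exact: (ucvg_cvg (uv j)).
have FF : ProperFilter \oo by exact: eventually_filter.
have [Glim GE] : exists Glim : network R, curve Glim = d.
  apply: network_of_curves.
  - move=> i k; apply: (lim_rV_eq FF (fun j => cpos i j 0 z01) (fun j => cpos k j 0 z01)).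
    by apply: (@filterE _ \oo) => n /=; exact: junction0.
  - move=> i k; apply: (lim_rV_eq FF (fun j => cpos i j 1 o01) (fun j => cpos k j 1 o01)).
    by apply: (@filterE _ \oo) => n /=; exact: junction1.
  - move=> i x y x01 y01.
    apply: (lim_eq FF (enorm_cvg FF (fun j => cvel i j x x01))
      (enorm_cvg FF (fun j => cvel i j y y01))).
    apply: (@filterE _ \oo) => n /=; rewrite (@constant_speed R (G (N + s n)) i x x01).
    by rewrite (@constant_speed R (G (N + s n)) i y y01).
exists (fun n => (N + s n)%N), Glim; rewrite GE; split.
- by move=> m n mn; rewrite ltn_add2l smono.
- by move=> i; have [] := sd i.
- by move=> alpha a12 i; have [_ _ _ H] := sd i; exact: H.
- apply: (@theta_or_degenerate_limit R (fun n => G (N + s n)) Glim C C0).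
  + by move=> n i; exact: (FE (s n)).2.
  + by rewrite GE.
  + by rewrite GE.
  + by move=> n; exact: (FE (s n)).1.
Qed.
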